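(* Assume conditions (i) and (ii) of the context. There exists a polynomial $h:\mathbb R^5\to\mathbb R$ such that for every $d\in\mathbb N$, every architecture $a$ with input dimension $d$, all $R,D\in(0,\infty)$, all $\varepsilon,\varrho\in(0,1)$ and every $m\in\mathbb N$ with $$m\ge h\big(\varepsilon^{-1},P(a),\log R,\varrho^{-1},D\big),$$ it holds with $\mathcal H=\mathcal N_{a,R,D}$ that $$\mathbb P\big(\mathcal E_d(f_{d,m,\mathcal H})-\mathcal E_d(f_{d,\mathcal H})\le\varepsilon\big)\ge1-\varrho.$$
   Context: Fix $T\in(0,\infty)$ and reals $u<v$. For each $d\in\mathbb N$: $\mu_d:\mathbb R^d\to\mathbb R^d$, $\sigma_d:\mathbb R^d\to\mathbb R^{d\times d}$ Lipschitz, $\varphi_d:\mathbb R^d\to\mathbb R$ measurable; on a probability space $(\Omega,\mathcal F,\mathbb P)$ with normal filtration $(\mathcal F_t)_{t\in[0,T]}$, $B$ a standard $d$-dimensional Brownian motion, $X_d:\Omega\to[u,v]^d$ uniform and $\mathcal F_0$-measurable, $(S_t)$ the continuous adapted solution of $S_t=X_d+\int_0^t\mu_d(S_s)ds+\int_0^t\sigma_d(S_s)dB_s$, $Y_d=S_T=(Y_{d,1},\dots,Y_{d,d})$. Risk $\mathcal E_d(f)=\mathbb E[(f(X_d)-\varphi_d(Y_d))^2]$; $(\mathbf x_i,\mathbf y_i)_{i\ge1}$ i.i.d. copies of $(X_d,Y_d)$; empirical risk $\mathcal E_{d,m}(f)=\frac1m\sum_{i=1}^m(f(\mathbf x_i)-\varphi_d(\mathbf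 y_i))^2$. For compact $\mathcal H\subseteq C([u,v]^d)$ (sup norm), $f_{d,\mathcal H}$ minimizes $\mathcal E_d$ over $\mathcal H$ and $f_{d,m,\mathcal H}:\Omega\to\mathcal H$ is a measurable minimizer of $\mathcal E_{d,m}$ over $\mathcal H$. Conditions: (i) there is $c_1\in(0,\infty)$ with $\mathbb P(|Y_{d,i}|\ge t)\le2\exp\{-c_1(\log t)^2\}$ for all $d$, $t\in[1,\infty)$, $i\le d$; (ii) there are $c_2\in(0,\infty)$, $\lambda\in[2,\infty)$ with $|\varphi_d(y)|\le c_2(1+\|y\|_2^\lambda)$ for all $d$, $y\in\mathbb R^d$. ReLU networks: architecture $a=(N_0,\dots,N_L)$ with $N_0=d$, $N_L=1$; parameters $\theta=((A_l,b_l))_{l=1}^L$, $A_l\in\mathbb R^{N_l\times N_{l-1}}$, $b_l\in\mathbb R^{N_l}$; $\Phi_\theta=W_L\circ\rho\circ\cdots\circ\rho\circ W_1$, $W_l(x)=A_lx+b_l$, $\rho$ componentwise ReLU; $\|\theta\|_\infty$ maximal absolute entry; $P(a)=\sum_{l=1}^LN_l(N_{l-1}+1)$; $\mathcal N_{a,R}=\{\Phi_\theta|_{[u,v]^d}:\|\theta\|_\infty\le R\}$; $\mathrm{Clip}_D(x)=\min\{|x|,D\}\operatorname{sgn}(x)$; $\mathcal N_{a,R,D}=\{\mathrm{Clip}_D\circ\Phi:\Phi\in\mathcal N_{a,R}\}$ (a compact subset of $C([u,v]^d)$). *)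

(* Defs.v *)
From HB Require Import structures.
From mathcomp Require Import all_boot all_order all_algebra.
From mathcomp Require Import all_classical all_reals all_analysis.
From mathcomp Require mpoly.
Set Implicit Arguments. Unset Strict Implicit. Unset Printing Implicit Defensive.
Import Order.TTheory GRing.Theory Num.Theory.
Import numFieldNormedType.Exports.
Local Open Scope classical_set_scope.
Local Open Scope ring_scope.

Section Defs.
Variable R : realType.

Definition cylRn (n : nat) : set (set ('I_n -> R)) :=
  [set A | exists (j : 'I_n) (B : set R), measurable B /\ A = [set x | B (x j)]].
Definition borelRn (n : nat) : set (set ('I_n -> R)) := smallest (sigma_algebra setT) (@cylRn n).

Definition borel_fun (n : nat) (g : ('I_n -> R) -> R) : Prop :=
  forall B : set R, measurable B -> @borelRn n (g @^-1` B).

Definition vcat (d : nat) (x y : 'I_d -> R) : 'I_(d + d) -> R :=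
  fun k => match fintype.split k with inl j => x j | inr j => y j end.

Definition norm2 (n : nat) (y : 'I_n -> R) : R := Num.sqrt (\sum_(j < n) y j ^+ 2).

Definition cube (u v : R) (d : nat) : set ('I_d -> R) := [set x | forall j, u <= x j <= v].

Context {dO : measure_display} {Omega : measurableType dO}.

Definition Pr (P : probability Omega R) (A : set Omega) : R := fine (P A).

Definition rvec (n : nat) (V : Omega -> ('I_n -> R)) : Prop :=
  forall j, measurable_fun setT (fun w => V w j).

Definition same_law (P : probability Omega R) (n : nat) (V W : Omega -> ('I_n -> R)) : Prop :=
  forall A, @borelRn n A -> P (V @^-1` A) = P (W @^-1` A).

Definition mutually_indep (P : probability Omega R) (n : nat) (V : nat -> Omega -> ('I_n -> R)) : Prop :=
  forall (s : seq nat) (A : nat -> set ('I_n -> R)), uniq s ->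
    (forall i, @borelRn n (A i)) ->
    Pr P (\bigcap_(i in [set i | i \in s]) (V i @^-1` A i)) = \prod_(i <- s) Pr P (V i @^-1` A i).

(* X uniformly distributed on [u,v]^d (law = normalized Lebesgue measure on the cube,
   characterized on Borel rectangles, which generate the Borel sets) *)
Definition uniform_cube (P : probability Omega R) (u v : R) (d : nat) (X : Omega -> ('I_d -> R)) : Prop :=
  forall B : 'I_d -> set R, (forall j, measurable (B j)) ->
    Pr P [set w | forall j, B j (X w j)] =
    \prod_(j < d) (fine (lebesgue_measure (B j `&` `[u, v])) / (v - u)).

End Defs.

Section Nets.
Variable R : realType.

(* Parameters theta: weights W l i j (layer l >= 1, row i < N_l, column j < N_(l-1)) and
   biases b l i.  Only these entries are relevant. *)
Definition affine (W : nat -> nat -> nat -> R) (b : nat -> nat -> R) (l prev : nat)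
  (z : nat -> R) : nat -> R := fun i => \sum_(j < prev) W l i j * z j + b l i.

Definition relu (z : nat -> R) : nat -> R := fun i => Num.max (z i) 0.

Fixpoint netrec (W : nat -> nat -> nat -> R) (b : nat -> nat -> R)
  (prev : nat) (ws : seq nat) (l : nat) (z : nat -> R) : nat -> R :=
  match ws with
  | [::] => z
  | n :: ws' => let z' := affine W b l prev z in
      if ws' is [::] then z' else netrec W b n ws' l.+1 (relu z')
  end.

Definition vext (d : nat) (x : 'I_d -> R) : nat -> R :=
  fun j => oapp x 0 (insub j : option 'I_d).

(* realization Phi_theta (output coordinate 0) for architecture a = [:: N_0; ...; N_L] *)
Definition realization (a : seq nat) (W : nat -> nat -> nat -> R) (b : nat -> nat -> R)
  (d : nat) (x : 'I_d -> R) : R :=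
  netrec W b (head 0%N a) (behead a) 1 (vext x) 0%N.

Fixpoint bounded_rec (W : nat -> nat -> nat -> R) (b : nat -> nat -> R) (Rr : R)
  (prev : nat) (ws : seq nat) (l : nat) : Prop :=
  match ws with
  | [::] => True
  | n :: ws' =>
      (forall i j, (i < n)%N -> (j < prev)%N -> `|W l i j| <= Rr) /\
      (forall i, (i < n)%N -> `|b l i| <= Rr) /\ bounded_rec W b Rr n ws' l.+1
  end.

Definition param_bounded (a : seq nat) W b (Rr : R) : Prop :=
  bounded_rec W b Rr (head 0%N a) (behead a) 1.

Definition arch (d : nat) (a : seq nat) : Prop :=
  (2 <= size a)%N /\ head 0%N a = d /\ last 0%N a = 1%N /\ all (fun n => 0 < n)%N a.

Fixpoint nparams_rec (prev : nat) (ws : seq nat) : nat :=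
  match ws with [::] => 0%N | n :: ws' => (n * (prev + 1) + nparams_rec n ws')%N end.
Definition nparams (a : seq nat) : nat := nparams_rec (head 0%N a) (behead a).

Definition clip (D x : R) : R := Num.sg x * Num.min `|x| D.

(* N_{a,R,D}: functions on [u,v]^d (only their values on the cube matter) *)
Definition NetClass (u v : R) (d : nat) (a : seq nat) (Rr D : R) : set (('I_d -> R) -> R) :=
  [set f | exists W b, param_bounded a W b Rr /\
     forall x, cube u v x -> f x = clip D (realization a W b x)].

End Nets.

(* Main.v *)
(** The part [phi(Y)^2] of the squared loss does not depend on [f], so only the cross loss
    [f^2 - 2 f phi(Y)] has to be controlled uniformly over the class.  Condition (i) makes
    [E phi(Y)^2] polynomial in [d], hence clipping [phi(Y)] at a polynomial level [K] costs
    at most [E phi(Y)^2 / K] in mean, and by Markov's inequality about as little in the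
    empirical mean.  The clipped cross loss is bounded, so Hoeffding's inequality applies on
    a finite grid of parameters; a network is Lipschitz in its parameters with a constant
    whose logarithm is polynomial in [P(a)] and [log R], so that the logarithm of the size
    of the grid is polynomial as well and a union bound over the grid suffices.  The
    expectation of a product that Hoeffding's inequality needs is computed on quantized
    variables, where it is a finite sum. *)
Require Import Defs.
From HB Require Import structures.
From mathcomp Require Import all_boot all_order all_algebra.
From mathcomp Require Import all_classical all_reals all_analysis.
From mathcomp Require mpoly.
From mathcomp Require Import measurable_realfun ring lra.
Set Implicit Arguments.
Unset Strict Implicit.
Unset Printing Implicit Defensive.
Import Order.TTheory GRing.Theory Num.Theory.
Import numFieldNormedType.Exports.
Local Open Scope classical_set_scope.
Local Open Scope ring_scope.

(** Condition (i) allows log-normal tails, so [phi(Y)] need not have exponential moments. The part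
    removed by clipping is therefore controlled by its first moment only. Markov's inequality then
    costs a factor [rho^-1], which a polynomial in [rho^-1] can afford. The polynomial is fixed
    before [d] and does not have [d] as an argument. The moment constants depend only on [c1], [c2]
    and [lam], and powers of [d] are dominated by powers of [P(a) >= d]. Since [ln R] may be
    negative, it enters only through its square. The good event is fixed before the network, so at
    each sample point it applies to whatever network the data select, without a measurable choice of
    parameters. Measurability is needed for the event in the conclusion, the risk of a random
    function: such a function is measurable in the sample and Lipschitz in the input, hence jointly
    measurable, and Tonelli's theorem applies. *)

Section quantize.
Variable R : realType.
Implicit Types B eta x : R.

(** One grid of mesh [eta] starting at [- B] serves loss values, network parameters and, with
    [B := - u], points of the cube. Indices come from rounding down, which makes the error
    one-sided. [Num.truncn] sends negative numbers to 0, hence the recurring condition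
    [- B <= x]. *)
Definition qlevel B eta (k : nat) : R := k%:R * eta - B.
Definition qindex B eta x : nat := Num.truncn ((x + B) / eta).

Lemma qindexP B eta x (k : nat) : 0 < eta -> - B <= x ->
  (qindex B eta x == k) = (qlevel B eta k <= x < qlevel B eta k + eta).
Proof.
move=> e0 Bx; rewrite /qindex /qlevel truncn_eq; last first.
  by rewrite divr_ge0 ?(ltW e0)// -lerBlDr sub0r.
rewrite ler_pdivlMr// ltr_pdivrMr// -natr1 mulrDl mul1r.
congr andb; first by rewrite lerBlDr.
by rewrite -ltrBrDr addrAC.
Qed.

Lemma qlevel_qindex B eta x : 0 < eta -> - B <= x ->
  qlevel B eta (qindex B eta x) <= x < qlevel B eta (qindex B eta x) + eta.
Proof. by move=> e0 Bx; rewrite -qindexP. Qed.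

Lemma qindex_ub B eta x : 0 < eta -> `|x| <= B ->
  (qindex B eta x < (Num.truncn (2 * B / eta)).+1)%N.
Proof.
move=> e0; rewrite ler_norml => /andP[Bx xB]; rewrite ltnS /qindex.
by apply: le_truncn; rewrite ler_wpM2r ?invr_ge0 ?(ltW e0)//; lra.
Qed.

Lemma qlevel_bounded B eta (k : nat) : 0 < eta -> 0 <= B ->
  (k < (Num.truncn (2 * B / eta)).+1)%N -> `|qlevel B eta k| <= B.
Proof.
move=> e0 B0; rewrite ltnS truncn_ge_nat; last by rewrite divr_ge0 ?(ltW e0)// mulr_ge0.
rewrite ler_pdivlMr// /qlevel => kB; rewrite ler_norml.
have : 0 <= k%:R * eta by rewrite mulr_ge0// ltW.
by move=> ?; apply/andP; split; lra.
Qed.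

End quantize.

(** * Hoeffding's inequality for finitely supported variables *)

Section finite_hoeffding.
Variable R : realType.

(** From [1 - x <= expR (- x)] follows [expR x * (1 - x) <= 1]; the right side times [1 - x] exceeds
    1 by [x^2 (1 - 2 x)], which is nonnegative here. *)
Lemma expR_le_quadratic (x : R) : x <= 2^-1 -> expR x <= 1 + x + 2 * x ^+ 2.
Proof.
move=> x2.
have h1 : 0 < 1 - x by lra.
have h2 : 1 - x <= expR (- x) by have := expR_ge1Dx (- x); lra.
have h3 : expR x * expR (- x) = 1 by rewrite expRN divff// gt_eqF ?expR_gt0.
have h4 : expR x * (1 - x) <= 1 by rewrite -[leRHS]h3 ler_wpM2l ?expR_ge0.
rewrite -(ler_pM2r h1); apply: (le_trans h4).
have : 0 <= x ^+ 2 * (1 - 2 * x) by rewrite mulr_ge0 ?sqr_ge0//; lra.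
have -> : (1 + x + 2 * x ^+ 2) * (1 - x) = 1 + x ^+ 2 * (1 - 2 * x) by ring.
lra.
Qed.

Variables (K : finType) (p c : K -> R) (B : R).
Hypotheses (p_ge0 : forall k, 0 <= p k) (p_sum : \sum_k p k = 1).
Hypotheses (B_gt0 : 0 < B) (cB : forall k, `|c k| <= B).

Let mu := \sum_k c k * p k.

Let mu_bound : `|mu| <= B.
Proof.
rewrite /mu (le_trans (ler_norm_sum _ _ _))//.
apply: (@le_trans _ _ (\sum_k B * p k)); last by rewrite -mulr_sumr p_sum mulr1.
by apply: ler_sum => k _; rewrite normrM (ger0_norm (p_ge0 k)) ler_wpM2r.
Qed.

(** Centering kills the linear term, and [|c k - mu| <= 2 B] turns the quadratic one into
    [2 (lam * 2 B)^2 = 8 (lam B)^2]. *)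
Lemma mgf_le (lam : R) : 0 <= lam -> lam * (2 * B) <= 2^-1 ->
  \sum_k expR (lam * (c k - mu)) * p k <= expR (8 * (lam * B) ^+ 2).
Proof.
move=> l0 lB.
apply: (@le_trans _ _ (1 + 8 * (lam * B) ^+ 2)); last exact: expR_ge1Dx.
apply: (@le_trans _ _ (\sum_k (1 + lam * (c k - mu) + 8 * (lam * B) ^+ 2) * p k)).
  apply: ler_sum => k _; apply: ler_wpM2r => //.
  have := cB k; move: mu_bound; rewrite !ler_norml => /andP[m1 m2] /andP[c1 c2].
  have h1 : lam * (c k - mu) <= lam * (2 * B) by rewrite ler_wpM2l//; lra.
  have h2 : lam * (mu - c k) <= lam * (2 * B) by rewrite ler_wpM2l//; lra.
  apply: (le_trans (expR_le_quadratic _)); first lra.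
  rewrite lerD2l.
  have -> : 8 * (lam * B) ^+ 2 = 2 * (lam * (2 * B)) ^+ 2 by ring.
  rewrite ler_wpM2l// -[leLHS]real_normK ?num_real// ler_sqr ?nnegrE//; last first.
    by rewrite mulr_ge0//; lra.
  by rewrite ler_norml; apply/andP; split; lra.
under eq_bigr => k _ do rewrite mulrDl mulrDl mul1r -mulrA mulrBl.
rewrite !big_split/= -mulr_sumr sumrB -/mu -!mulr_sumr p_sum.
by rewrite !mulr1 subrr mulr0 addr0.
Qed.

Lemma hoeffding_finite (m : nat) (eps : R) : 0 < eps -> eps <= 4 * B ->
  \sum_(k : {ffun 'I_m -> K} | m%:R * (mu + eps) <= \sum_i c (k i)) \prod_i p (k i)
  <= expR (- (m%:R * (eps ^+ 2 / (32 * B ^+ 2)))).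
Proof.
(* This [lam] minimizes [8 (lam B)^2 - lam eps], with value [- eps^2 / (32 B^2)]; [eps <= 4 B] says
   exactly that [lam * 2 B <= 1/2]. *)
move=> e0 eB; pose lam := eps / (16 * B ^+ 2).
have l0 : 0 <= lam by rewrite divr_ge0 ?(ltW e0)// mulr_ge0// sqr_ge0.
have lB : lam * (2 * B) <= 2^-1.
  rewrite /lam (_ : _ * _ = eps / (8 * B)); last by field; rewrite gt_eqF.
  by rewrite ler_pdivrMr; lra.
(* Chernoff's trick: on the event the product of the exponentials is at least 1. The resulting sum
   over all [k] factors into an [m]-th power. *)
apply: (@le_trans _ _ (\sum_(k : {ffun 'I_m -> K})
    \prod_i (expR (lam * (c (k i) - mu) - lam * eps) * p (k i)))).
  rewrite big_mkcond/=; apply: ler_sum => k _; case: ifPn => [h|_]; last first.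
    by apply: prodr_ge0 => i _; rewrite mulr_ge0// expR_ge0.
  rewrite big_split/= ler_peMl//; first by apply: prodr_ge0.
  rewrite -expR_sum -[leLHS]expR0 ler_expR.
  under eq_bigr => i _ do rewrite mulrBr -addrA -opprD -mulrDr.
  rewrite sumrB sumr_const card_ord -mulr_sumr -mulr_natr.
  have := ler_wpM2l l0 h; lra.
rewrite -(bigA_distr_bigA (fun (i : 'I_m) k => expR (lam * (c k - mu) - lam * eps) * p k))/=.
rewrite prodr_const card_ord -(mulrN m%:R) expRM_natl.
apply: lerXn2r; rewrite ?nnegrE ?expR_ge0//.
  by apply: sumr_ge0 => k _; rewrite mulr_ge0// expR_ge0.
under eq_bigr => k _ do rewrite expRD mulrAC.
rewrite -mulr_suml (le_trans (ler_wpM2r (expR_ge0 _) (mgf_le l0 lB)))//.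
rewrite -expRD ler_expR /lam le_eqVlt; apply/orP; left; apply/eqP.
by field; rewrite gt_eqF.
Qed.

End finite_hoeffding.

(** * Hoeffding and Markov bounds for i.i.d. samples *)

Section iid.
Context (R : realType) (dO dS : measure_display) (Omega : measurableType dO)
  (S : measurableType dS) (P : probability Omega R).
Variables (V : nat -> Omega -> S) (V0 : Omega -> S).
Hypothesis mV : forall i, measurable_fun setT (V i).
Hypothesis mV0 : measurable_fun setT V0.
Hypothesis V_law : forall i A, measurable A -> P (V i @^-1` A) = P (V0 @^-1` A).
Hypothesis V_indep : forall (s : seq nat) (A : nat -> set S), uniq s ->
  (forall i, measurable (A i)) ->
  Pr P (\bigcap_(i in [set i | i \in s]) (V i @^-1` A i)) =
  \prod_(i <- s) Pr P (V i @^-1` A i).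

Lemma measure_bigsetU_le (I : finType) (Q : pred I) (A : I -> set Omega) :
  (forall i, measurable (A i)) ->
  (P (\big[setU/set0]_(i | Q i) A i) <= \sum_(i | Q i) P (A i))%E.
Proof.
move=> mA; elim: (index_enum I) => [|i s IH]; first by rewrite !big_nil measure0.
rewrite !big_cons; case: ifP => // _.
apply: le_trans (measureU2 P _ _) _ => //; first exact: bigsetU_measurable.
by rewrite leeD2l.
Qed.

Lemma Rintegral_probT (r : R) : (\int[P]_w r)%R = r.
Proof.
rewrite (Rintegral_cst P measurableT) -[RHS]mulr1; congr (_ * _).
by rewrite /= probability_setT.
Qed.

Section discrete.
Variables (K : finType) (q : S -> K).
Hypothesis mq : forall k, measurable (q @^-1` [set k]).

Let p k := Pr P (V0 @^-1` (q @^-1` [set k])).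

Let mq0 k : measurable (V0 @^-1` (q @^-1` [set k])).
Proof. by rewrite -[X in measurable X]setTI; apply: mV0. Qed.

Lemma Rintegral_discrete (c : K -> R) :
  (\int[P]_w c (q (V0 w)))%R = \sum_k c k * p k.
Proof.
have cE w : c (q (V0 w)) = \sum_k c k * \1_(V0 @^-1` (q @^-1` [set k])) w.
  rewrite (bigD1 (q (V0 w)))//= indicE mem_set//= mulr1 big1 ?addr0// => k kq.
  rewrite indicE memNset ?mulr0//= => /esym/eqP; exact/negP.
rewrite /Rintegral; under eq_integral => w _ do rewrite cE -sumEFin.
rewrite integral_sum//; last first.
  move=> k; under [X in _.-integrable _ X]eq_fun do rewrite EFinM.
  by apply: integrableZl => //; exact: integrable_indic.
rewrite -[RHS]/(fine (\sum_k c k * p k)%:E) -sumEFin; congr fine.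
apply: eq_bigr => k _; under eq_integral do rewrite EFinM.
rewrite integralZl//; last exact: integrable_indic.
by rewrite integral_indic// setIT EFinM /p /Pr fineK// fin_num_measure.
Qed.

Let p_sum1 : \sum_k p k = 1.
Proof.
have := Rintegral_discrete (fun=> 1); rewrite Rintegral_probT => /esym.
by under eq_bigr do rewrite mul1r.
Qed.

(** The event depends only on the vector of quantized samples, so it is a finite union of cells
    [F k], and independence gives each cell the product probability. *)
Lemma hoeffding_discrete (c : K -> R) (B : R) (m : nat) (eps : R) :
  0 < B -> (forall k, `|c k| <= B) -> 0 < eps -> eps <= 4 * B ->
  let E := [set w | m%:R * ((\int[P]_w c (q (V0 w)))%R + eps)
                    <= \sum_(i < m) c (q (V i w))] in
  measurable E /\
  (P E <= (expR (- (m%:R * (eps ^+ 2 / (32 * B ^+ 2)))))%:E)%E.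
Proof.
move=> B0 cB e0 eB E.
(* Independence is stated for families indexed by all naturals; [setT] fills the indices from [m]
   on. *)
pose A (k : {ffun 'I_m -> K}) (i : nat) : set S :=
  if (insub i : option 'I_m) is Some j then q @^-1` [set k j] else setT.
have mA k i : measurable (A k i) by rewrite /A; case: insubP.
pose F (k : {ffun 'I_m -> K}) := \bigcap_(i in [set i | i \in iota 0 m]) (V i @^-1` A k i).
have mF k : measurable (F k).
  apply: bigcap_measurableType => i _.
  by rewrite -[X in measurable X]setTI; apply: mV.
have FP k w : F k w <-> forall i : 'I_m, q (V i w) = k i.
  split=> [Fkw i|h i /=].
    have := Fkw i; rewrite /= mem_iota /= add0n ltn_ord => /(_ isT).
    by rewrite /A valK.
  by rewrite mem_iota add0n /= => im; rewrite /A insubT/= -h.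
have PF k : P (F k) = (\prod_i p (k i))%:E.
  rewrite -[LHS]fineK ?fin_num_measure//; congr EFin.
  rewrite -/(Pr P (F k)) V_indep ?iota_uniq//.
  have -> : iota 0 m = index_iota 0 m by rewrite /index_iota subn0.
  rewrite big_mkord; apply: eq_bigr => i _.
  by rewrite /Pr V_law// /A valK.
pose Q (k : {ffun 'I_m -> K}) := m%:R * (\sum_k c k * p k + eps) <= \sum_i c (k i).
have EE : E = \big[setU/set0]_(k | Q k) F k.
  apply/seteqP; split=> w /=.
    rewrite /E/= Rintegral_discrete => Ew; pose k := [ffun i : 'I_m => q (V i w)].
    rewrite -bigcup_pred.
    exists k; last by apply/FP => i; rewrite ffunE.
    suff : Q k by [].
    rewrite /Q; apply: (le_trans Ew); rewrite le_eqVlt; apply/orP; left.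
    by apply/eqP/eq_bigr => i _; rewrite ffunE.
  rewrite -bigcup_pred => -[k Qk' /FP h]; have Qk : Q k by [].
  rewrite /E/= Rintegral_discrete (le_trans Qk)// le_eqVlt; apply/orP; left.
  by apply/eqP/eq_bigr => i _; rewrite h.
split; first by rewrite EE; exact: bigsetU_measurable.
rewrite EE (le_trans (measure_bigsetU_le _ mF))//.
under eq_bigr => k _ do rewrite PF.
rewrite sumEFin lee_fin; apply: (@hoeffding_finite R K p c B) => // k.
by rewrite /p /Pr fine_ge0.
Qed.

End discrete.


Lemma bounded_integrable (g : S -> R) (B : R) : measurable_fun setT g ->
  (forall x, `|g x| <= B) -> P.-integrable setT (EFin \o (g \o V0)).
Proof.
move=> mg gB; apply: measurable_bounded_integrable => //.
- by rewrite /= probability_setT ltry.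
- exact: measurableT_comp.
- exists B; split; first exact: num_real.
  by move=> x Bx w _ /=; rewrite (le_trans (gB _))// ltW.
Qed.

Lemma hoeffding (g : S -> R) (B : R) (m : nat) (eps : R) :
  measurable_fun setT g -> 0 < B -> (forall x, `|g x| <= B) ->
  0 < eps -> eps <= B ->
  (P [set w | (m%:R * ((\int[P]_w g (V0 w))%R + eps) <= \sum_(i < m) g (V i w))%R]
   <= (expR (- (m%:R * (eps ^+ 2 / (128 * B ^+ 2)))))%:E)%E.
Proof.
move=> mg B0 gB e0 eB; set E := [set w | _].
(* Rounding [g] down does not raise its mean and lowers the empirical mean by at most [eps / 2]. An
   excess of [eps] for [g] thus forces one of [eps / 2] for [c \o q], which turns 32 into 128. *)
pose eta := eps / 2; have eta0 : 0 < eta by rewrite divr_gt0.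
pose N := Num.truncn (2 * B / eta).
pose q x : 'I_N.+1 := inord (qindex B eta (g x)).
have qE x : q x = qindex B eta (g x) :> nat by rewrite inordK// qindex_ub.
have gB' x : - B <= g x by have := gB x; rewrite ler_norml => /andP[].
pose c (k : 'I_N.+1) := qlevel B eta k.
have cq x : c (q x) <= g x < c (q x) + eta by rewrite /c qE qlevel_qindex.
have cB k : `|c k| <= B by rewrite qlevel_bounded// ltW.
have mq k : measurable (q @^-1` [set k]).
  rewrite (_ : _ @^-1` _ = g @^-1` `[c k, c k + eta[).
    by rewrite -[X in measurable X]setTI; apply: mg.
  apply/seteqP; split=> x /=; rewrite in_itv/=.
    by move=> <-.
  by rewrite -qindexP// => /eqP h; apply/val_inj; rewrite /= qE.
have mcq : measurable_fun setT (c \o q).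
  have -> : c \o q = fun x => \sum_k c k * \1_(q @^-1` [set k]) x.
    apply/funext => x /=.
    rewrite (bigD1 (q x))//= indicE mem_set//= mulr1 big1 ?addr0// => k kq.
    by rewrite indicE memNset ?mulr0//= => /esym/eqP; exact/negP.
  apply: measurable_sum => k; apply: measurable_funM => //; exact: measurable_indic.
have [mF PF] := @hoeffding_discrete _ q mq c B m eta B0 cB eta0 ltac:(rewrite /eta; lra).
apply: (@le_trans _ _ (P [set w | m%:R * ((\int[P]_w c (q (V0 w)))%R + eta)
                    <= \sum_(i < m) c (q (V i w))])); last first.
  apply: (le_trans PF); rewrite lee_fin ler_expR lerN2 ler_wpM2l//.
  rewrite /eta le_eqVlt; apply/orP; left; apply/eqP; field.
  by rewrite gt_eqF.
apply: le_measure; rewrite ?inE//.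
  rewrite -[E]setTI; apply: measurable_fun_le => //.
  by apply: measurable_sum => i; exact: measurableT_comp.
move=> w /= Ew.
have h1 : (\int[P]_w c (q (V0 w)) <= \int[P]_w g (V0 w))%R.
  apply: le_Rintegral => //.
  - exact: (bounded_integrable mcq (fun x => cB (q x))).
  - exact: (bounded_integrable mg gB).
  - by move=> x _; case/andP: (cq (V0 x)).
have h2 : \sum_(i < m) g (V i w) <= \sum_(i < m) c (q (V i w)) + m%:R * eta.
  rewrite -[m%:R * eta]mulrC mulr_natr -[m in _ *+ m]card_ord -sumr_const -big_split/=.
  by apply: ler_sum => i _; case/andP: (cq (V i w)) => _ /ltW.
have h3 : m%:R * ((\int[P]_w c (q (V0 w)))%R + eps) <= m%:R * ((\int[P]_w g (V0 w))%R + eps).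
  by rewrite ler_wpM2l// lerD2r.
move: Ew h2 h3; rewrite /E /= {mF PF}.
set a := (\int[P]_w g _)%R; set b := (\int[P]_w c _)%R; move: (m%:R) => M.
rewrite /eta !mulrDr; lra.
Qed.

Lemma eq_law_integral i (g : S -> R) : measurable_fun setT g -> (forall x, 0 <= g x) ->
  (\int[P]_w (g (V i w))%:E = \int[P]_w (g (V0 w))%:E)%E.
Proof.
move=> mg g0.
have mgE : measurable_fun setT (EFin \o g) by exact/measurable_EFinP.
have E (W : Omega -> S) : measurable_fun setT W ->
   (\int[P]_w (g (W w))%:E = \int[pushforward P W]_x (g x)%:E)%E.
  by move=> mW; rewrite ge0_integral_pushforward// => x _; rewrite lee_fin.
rewrite !E//; apply: eq_measure_integral => A mA _.
exact: V_law.
Qed.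

(** Equality in law gives the sum the mean [m] times that of [g (V0)]; Markov's inequality is then
    applied to the sum. *)
Lemma markov_mean (g : S -> R) (m : nat) (s t : R) :
  measurable_fun setT g -> (forall x, 0 <= g x) -> 0 < s -> (0 < m)%N ->
  (\int[P]_w (g (V0 w))%:E <= t%:E)%E ->
  (P [set w | (m%:R * s <= \sum_(i < m) g (V i w))%R] <= (t / s)%:E)%E.
Proof.
move=> mg g0 s0 m0 It; set E := [set w | _].
have mgV i : measurable_fun setT (fun w => g (V i w)) by exact: measurableT_comp.
have mE : measurable E.
  by rewrite -[E]setTI; apply: measurable_fun_le => //; exact: measurable_sum.
have ms0 : 0 < m%:R * s by rewrite mulr_gt0// ltr0n.
have h : ((m%:R * s)%:E * P E <= (m%:R * t)%:E)%E.
  rewrite -{1}[E]setIT -integral_indic// -integralZl//; last exact: integrable_indic.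
  apply: (@le_trans _ _ (\int[P]_w (\sum_(i < m) (g (V i w))%:E))%E).
    apply: ge0_le_integral => //.
    - by move=> w _; rewrite mule_ge0 ?lee_fin// ltW.
    - by apply: measurable_funeM; exact/measurable_EFinP.
    - by apply: emeasurable_sum => i; exact/measurable_EFinP.
    - move=> w _; rewrite sumEFin -EFinM lee_fin indicE.
      have [wE|wE] := boolP (w \in E); first by rewrite mulr1; move/set_mem: wE.
      by rewrite mulr0 sumr_ge0.
  rewrite ge0_integral_sum; [|by []|by move=> i; exact/measurable_EFinP|by move=> i w _; rewrite lee_fin].
  under eq_bigr => i _ do rewrite eq_law_integral//.
  apply: (@le_trans _ _ (\sum_(i < m) t%:E)%E); first exact: lee_sum.
  by rewrite sumEFin lee_fin sumr_const card_ord mulr_natl.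
rewrite -(@lee_pmul2l _ (m%:R * s)%:E)// ?lte_fin//.
by rewrite -EFinM -mulrA (mulrC s) divfK// gt_eqF.
Qed.

End iid.

(** * Clipping *)

Section clip.
Variable R : realType.
Implicit Types x y D : R.

(** With [clip] as a composition of lattice operations, the Lipschitz bound and measurability follow
    one factor at a time. *)
Lemma clipE D x : 0 < D -> clip D x = Num.min (Num.max x (- D)) D.
Proof.
move=> D0; rewrite /clip; have [x0|x0|->] := ltgtP x 0.
- rewrite ltr0_sg// mulN1r ltr0_norm// oppr_min opprK.
  rewrite [RHS]min_l//; rewrite ge_max; apply/andP; split; lra.
- by rewrite gtr0_sg// mul1r gtr0_norm// max_l//; lra.
- by rewrite sgr0 mul0r max_l ?min_l//; lra.
Qed.

Lemma clip_bounded D x : 0 < D -> `|clip D x| <= D.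
Proof.
move=> D0; rewrite clipE// ler_norml; apply/andP; split.
  by rewrite le_min le_max lexx orbT/=; lra.
by rewrite ge_min lexx orbT.
Qed.

Lemma maxr_lip (c x y : R) : `|Num.max x c - Num.max y c| <= `|x - y|.
Proof.
wlog xy : x y / y <= x.
  by have [?|/ltW ?] := leP y x; [exact | rewrite distrC (distrC x); exact].
rewrite [leRHS]ger0_norm ?subr_ge0// ler_norml.
by have [?|?] := leP x c; have [?|?] := leP y c; apply/andP; split; lra.
Qed.

Lemma minr_lip (c x y : R) : `|Num.min x c - Num.min y c| <= `|x - y|.
Proof.
have E (t : R) : Num.min t c = - Num.max (- t) (- c) by rewrite oppr_max !opprK.
by rewrite !E -opprD normrN (le_trans (maxr_lip _ _ _))// -opprD normrN.
Qed.

Lemma clip_lip D x y : 0 < D -> `|clip D x - clip D y| <= `|x - y|.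
Proof.
by move=> D0; rewrite !clipE// (le_trans (minr_lip _ _ _))// maxr_lip.
Qed.

Lemma measurable_clip D : 0 < D -> measurable_fun setT (@clip R D).
Proof.
move=> D0; rewrite (_ : clip D = fun x => Num.min (Num.max x (- D)) D).
  by apply: measurable_minr => //; apply: measurable_maxr.
by apply/funext => x; rewrite clipE.
Qed.

End clip.

(** * Networks: sensitivity to the parameters, and the finite grid *)

Section nets.
Variable R : realType.
Implicit Types (W : nat -> nat -> nat -> R) (b : nat -> nat -> R) (z : nat -> R).

Lemma relu_lip z z' i : `|relu z i - relu z' i| <= `|z i - z' i|.
Proof. exact: maxr_lip. Qed.

Lemma relu_bound z i : `|relu z i| <= `|z i|.
Proof.
have := relu_lip z (fun=> 0) i.
by rewrite {2}/relu maxxx !subr0.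
Qed.

Lemma affine_bound W b l n (M Rb : R) z i :
  (forall j, (j < n)%N -> `|W l i j| <= Rb) -> `|b l i| <= Rb ->
  1 <= M -> 0 <= Rb -> (forall j, (j < n)%N -> `|z j| <= M) ->
  `|affine W b l n z i| <= n.+1%:R * Rb * M.
Proof.
move=> hW hb M1 R0 hz; rewrite /affine (le_trans (ler_normD _ _))//.
rewrite -natr1 !mulrDl mul1r; apply: lerD; last first.
  by rewrite (le_trans hb)// ler_peMr.
rewrite (le_trans (ler_norm_sum _ _ _))//.
rewrite -mulrA mulr_natl -[n in leRHS]card_ord -sumr_const; apply: ler_sum => j _.
by rewrite normrM ler_pM// ?hW ?hz// ltn_ord.
Qed.

Lemma affine_diff W b W' b' l n (M Rb delta : R) z z' i :
  (forall j, (j < n)%N -> `|W l i j| <= Rb) ->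
  (forall j, (j < n)%N -> `|W l i j - W' l i j| <= delta) ->
  `|b l i - b' l i| <= delta ->
  1 <= M -> 1 <= Rb -> 0 <= delta ->
  (forall j, (j < n)%N -> `|z' j| <= M) ->
  (forall j, (j < n)%N -> `|z j - z' j| <= delta * M) ->
  `|affine W b l n z i - affine W' b' l n z' i| <= delta * M * (2 * n.+1%:R * Rb).
Proof.
move=> hW hWW hb M1 R1 d0 hz hzz.
have -> : affine W b l n z i - affine W' b' l n z' i =
    \sum_(j < n) (W l i j * (z j - z' j) + (W l i j - W' l i j) * z' j)
    + (b l i - b' l i).
  rewrite /affine opprD addrACA -sumrB; congr (_ + _).
  by apply: eq_bigr => j _; ring.
apply: (@le_trans _ _ (\sum_(j < n) (2 * Rb * delta * M) + delta)).
  rewrite (le_trans (ler_normD _ _))// lerD//.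
  rewrite (le_trans (ler_norm_sum _ _ _))//; apply: ler_sum => j _.
  rewrite (le_trans (ler_normD _ _))// !normrM.
  have h1 : `|W l i j| * `|z j - z' j| <= Rb * (delta * M) by rewrite ler_pM// ?hW// hzz.
  have h2 : `|W l i j - W' l i j| * `|z' j| <= delta * M by rewrite ler_pM// ?hWW// hz.
  have h3 : delta * M <= Rb * (delta * M) by rewrite ler_peMl// mulr_ge0//; lra.
  lra.
rewrite sumr_const card_ord -[X in X + _]mulr_natr -[n.+1]addn1 natrD.
have h1 : delta <= delta * M by rewrite ler_peMr.
have h3 : delta * M <= delta * M * Rb by rewrite ler_peMr// mulr_ge0//; lra.
move: (n%:R) => N; lra.
Qed.

(** One number [M] both bounds the activations and scales the error [delta * M]. A layer multiplies
    both by at most [2 * p.+1 * Rb], so the invariant reproduces itself; the 2 accounts for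
    propagated error plus parameter error, and [1 <= M], [1 <= Rb] absorb the biases. *)
Lemma netrec_diff W b W' b' (p : nat) (Rb delta : R) ws prev l z z' (M : R) :
  (prev <= p)%N -> all (fun n => n <= p)%N ws -> 1 <= Rb -> 0 <= delta -> 1 <= M ->
  bounded_rec W b Rb prev ws l -> bounded_rec W' b' Rb prev ws l ->
  bounded_rec (fun l i j => W l i j - W' l i j) (fun l i => b l i - b' l i)
    delta prev ws l ->
  (forall j, (j < prev)%N -> `|z j| <= M) ->
  (forall j, (j < prev)%N -> `|z' j| <= M) ->
  (forall j, (j < prev)%N -> `|z j - z' j| <= delta * M) ->
  forall i, (i < last prev ws)%N ->
  `|netrec W b prev ws l z i - netrec W' b' prev ws l z' i|
   <= delta * M * (2 * p.+1%:R * Rb) ^+ size ws.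
Proof.
elim: ws prev l z z' M => [|n ws IH] prev l z z' M prevp.
  by move=> _ _ _ _ _ _ _ _ _ hz i /= ip; rewrite expr0 mulr1 hz.
move=> /= /andP[np wsp] R1 d0 M1 [hW [hb hB]] [hW' [hb' hB']] [hD [hd hBd]] hz hz' hzz.
set S := 2 * p.+1%:R * Rb.
have Rb0 : 0 <= Rb by lra.
have prevS : 2 * prev.+1%:R * Rb <= S by rewrite ler_wpM2r// ler_wpM2l// ler_nat.
have S1 : 1 <= S.
  have h : 1 <= p.+1%:R * Rb by rewrite mulr_ege1// ler1n.
  rewrite /S; lra.
have prevS' : prev.+1%:R * Rb * M <= M * S.
  rewrite mulrC ler_wpM2l//; first lra.
  by apply: le_trans prevS; rewrite ler_wpM2r// ler_peMl//; lra.
have d1 i : (i < n)%N -> `|affine W b l prev z i - affine W' b' l prev z' i| <= delta * (M * S).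
  move=> ni; apply: le_trans (_ : delta * M * (2 * prev.+1%:R * Rb) <= _).
    by apply: affine_diff => //; [move=> j; exact: hW | move=> j; exact: hD | exact: hd].
  by rewrite (mulrA delta M S) ler_wpM2l// mulr_ge0//; lra.
case: ws IH wsp hB hB' hBd => [|n' ws] IH wsp hB hB' hBd i /= ip.
  by rewrite expr1 -mulrA d1.
rewrite exprS mulrA -(mulrA delta); apply: IH => //.
- by rewrite mulr_ege1.
- move=> j jn; rewrite (le_trans (relu_bound _ _))// (le_trans _ prevS')//.
  by apply: affine_bound => //; [move=> k; exact: hW | exact: hb].
- move=> j jn; rewrite (le_trans (relu_bound _ _))// (le_trans _ prevS')//.
  by apply: affine_bound => //; [move=> k; exact: hW' | exact: hb'].
- by move=> j jn; rewrite (le_trans (relu_lip _ _ _))// d1.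
Qed.

(** The implication is asked only for layers, rows and columns in range. It serves both to enlarge a
    bound and to pass from [W] to its distance from the grid, where out-of-range indices would
    collide under [inord]. *)
Lemma bounded_rec_imp (p : nat) W b W' b' (r r' : R) ws prev l :
  (prev <= p)%N -> all (fun n => n <= p)%N ws ->
  (forall l' i j, (l <= l' < l + size ws)%N -> (i < p)%N -> (j < p)%N ->
     `|W l' i j| <= r -> `|W' l' i j| <= r') ->
  (forall l' i, (l <= l' < l + size ws)%N -> (i < p)%N ->
     `|b l' i| <= r -> `|b' l' i| <= r') ->
  bounded_rec W b r prev ws l -> bounded_rec W' b' r' prev ws l.
Proof.
elim: ws prev l => // n ws IH prev l prevp /= /andP[np wsp] hW hb [bW [bb bB]].
have ll : (l <= l < l + (size ws).+1)%N by rewrite leqnn/= addnS ltnS leq_addr.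
split=> [i j ni jp|].
  by apply: hW => //; [exact: leq_trans np | exact: leq_trans prevp | exact: bW].
split=> [i ni|].
  by apply: hb => //; [exact: leq_trans np | exact: bb].
have ll' l' : (l.+1 <= l' < l.+1 + size ws)%N -> (l <= l' < l + (size ws).+1)%N.
  by rewrite addSnnS => /andP[/ltnW -> ->].
by apply: IH bB => // [l' i j /ll'|l' i /ll']; [exact: hW | exact: hb].
Qed.

Lemma nparams_rec_bounds ws prev : ws != [::] -> all (fun n => 0 < n)%N ws ->
  [/\ (prev <= nparams_rec prev ws)%N, (size ws <= nparams_rec prev ws)%N &
      all (fun n => n <= nparams_rec prev ws)%N ws].
Proof.
move=> + ws0; move=> wsN; split.
- case: ws ws0 wsN => //= n ws /andP[n0 _] _.
  rewrite (leq_trans _ (leq_addr _ _))// -[prev in (prev <= _)%N]mul1n.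
  by rewrite leq_mul// addn1.
- elim: ws ws0 prev {wsN} => //= n ws IH /andP[n0 ws0] prev.
  rewrite -add1n leq_add ?IH//.
  by rewrite muln_gt0 n0 addn1.
- elim: ws ws0 prev {wsN} => //= n ws IH /andP[n0 ws0] prev; apply/andP; split.
    rewrite (leq_trans _ (leq_addr _ _))// -[n in (n <= _)%N]muln1.
    by rewrite leq_mul// addn1.
  apply: sub_all (IH ws0 n) => k /= kn.
  by rewrite (leq_trans kn)// leq_addl.
Qed.

(** Input dimension, depth and widths are all controlled by the single number [P(a)], which can
    therefore index layers, rows and columns alike. *)
Lemma nparams_bounds d a : arch d a ->
  [/\ (d <= nparams a)%N, (size (behead a) <= nparams a)%N,
      all (fun n => n <= nparams a)%N (behead a) & (0 < nparams a)%N].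
Proof.
case: a => [|n [|n' ws]]; [by case|by case|].
move=> [_ [/= <- [_ /andP[n0 ws0]]]].
have [h1 h2 h3] := @nparams_rec_bounds (n' :: ws) n isT ws0.
split => //; exact: leq_ltn_trans h2.
Qed.

Lemma vext_bound (u v : R) d (x : 'I_d -> R) j :
  cube u v x -> `|vext x j| <= 1 + `|u| + `|v|.
Proof.
move=> cx; rewrite /vext; case: insubP => [i _ _|_] /=; last first.
  by rewrite normr0 !addr_ge0.
have /andP[ux xv] := cx i.
have := ler_norm v; have := ler_norm (- u); rewrite normrN => h1 h2.
have := normr_ge0 u; have := normr_ge0 v => h3 h4.
by rewrite ler_norml; apply/andP; split; lra.
Qed.

Lemma vext_diff d (x x' : 'I_d -> R) (e : R) j : 0 <= e ->
  (forall i, `|x i - x' i| <= e) -> `|vext x j - vext x' j| <= e.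
Proof.
by move=> e0 h; rewrite /vext; case: insubP => [i _ _|_] //=; rewrite subr0 normr0.
Qed.

(** Inputs and parameters vary together so that one bound yields two facts: the grid approximation
    ([x = x']) and the Lipschitz bound in the input ([W = W']). The summand 1 in [1 + |u| + |v|]
    guarantees the [1 <= M] of the recursion. *)
Lemma realization_diff (u v Rb delta : R) d a W b W' b' (x x' : 'I_d -> R) :
  arch d a -> 1 <= Rb -> 0 <= delta ->
  param_bounded a W b Rb -> param_bounded a W' b' Rb ->
  param_bounded a (fun l i j => W l i j - W' l i j) (fun l i => b l i - b' l i) delta ->
  cube u v x -> cube u v x' ->
  (forall i, `|x i - x' i| <= delta * (1 + `|u| + `|v|)) ->
  `|realization a W b x - realization a W' b' x'|
  <= delta * (1 + `|u| + `|v|) * (2 * (nparams a).+1%:R * Rb) ^+ nparams a.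
Proof.
move=> ha R1 d0 hW hW' hD cx cx' xx'.
have [h1 h2 h3 h4] := nparams_bounds ha.
have U1 : 1 <= 1 + `|u| + `|v| by rewrite -addrA lerDl addr_ge0.
have U0 : 0 <= 1 + `|u| + `|v| by lra.
have S1 : 1 <= 2 * (nparams a).+1%:R * Rb.
  have h : 1 <= (nparams a).+1%:R * Rb by rewrite mulr_ege1// ler1n.
  lra.
have hh : head 0%N a = d by case: ha => _ [].
have hl : last (head 0%N a) (behead a) = 1%N.
  case: ha => + [_ []]; by case: (a).
rewrite /realization (le_trans (netrec_diff (p := nparams a) (M := 1 + `|u| + `|v|)
  (Rb := Rb) (delta := delta) _ _ _ _ _ hW hW' hD _ _ _ _))//.
- by rewrite hh.
- by move=> j _; exact: vext_bound.
- by move=> j _; exact: vext_bound.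
- by move=> j _; apply: vext_diff => //; exact: mulr_ge0.
- by rewrite hl.
(* The depth in the exponent may be raised to [nparams a] because the base is at least 1. *)
- by rewrite ler_wpM2l ?mulr_ge0// ler_weXn2l.
Qed.

Section grid.
Variables (p : nat) (Rr delta : R).
Let K := Num.truncn (2 * Rr / delta).

(** A full cube of [(p + 1)^3] entries, whatever the shape of the architecture: the overcount keeps
    the cardinality explicit and its logarithm polynomial. *)
Definition grid_index := {ffun 'I_p.+1 * 'I_p.+1 * 'I_p.+1 -> 'I_K.+1}.

Definition gridW (k : grid_index) (l i j : nat) : R :=
  qlevel Rr delta (k (inord l, inord i, inord j)).

(* Columns of weight matrices are numbered below [p], so column [p] is free to hold the bias. *)
Definition gridb (k : grid_index) (l i : nat) : R :=
  qlevel Rr delta (k (inord l, inord i, inord p)).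

Definition grid_of W b : grid_index :=
  [ffun t : 'I_p.+1 * 'I_p.+1 * 'I_p.+1 => inord (qindex Rr delta
    (if t.2 == p :> nat then b t.1.1 t.1.2 else W t.1.1 t.1.2 t.2))].

Hypotheses (delta_gt0 : 0 < delta) (Rr_gt0 : 0 < Rr).

Lemma gridW_bounded k l i j : `|gridW k l i j| <= Rr.
Proof. by apply: qlevel_bounded => //; exact: ltW. Qed.

Lemma gridb_bounded k l i : `|gridb k l i| <= Rr.
Proof. by apply: qlevel_bounded => //; exact: ltW. Qed.

Let close x : `|x| <= Rr ->
  `|x - qlevel Rr delta (inord (qindex Rr delta x) : 'I_K.+1)| <= delta.
Proof.
move=> xR; rewrite inordK ?qindex_ub//.
have xl : - Rr <= x by move: xR; rewrite ler_norml => /andP[].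
have /andP[h1 h2] := qlevel_qindex delta_gt0 xl.
by rewrite ger0_norm ?subr_ge0//; lra.
Qed.

Lemma gridW_close W b l i j : (l <= p)%N -> (i < p)%N -> (j < p)%N ->
  `|W l i j| <= Rr -> `|W l i j - gridW (grid_of W b) l i j| <= delta.
Proof.
move=> lp ip jp hW; rewrite /gridW ffunE/= (@inordK p l)// (@inordK p i) 1?ltnW//.
rewrite (@inordK p j) 1?ltnW//.
by rewrite (ltn_eqF jp) close.
Qed.

Lemma gridb_close W b l i : (l <= p)%N -> (i < p)%N ->
  `|b l i| <= Rr -> `|b l i - gridb (grid_of W b) l i| <= delta.
Proof.
move=> lp ip hW; rewrite /gridb ffunE/= (@inordK p l)// (@inordK p i) 1?ltnW//.
rewrite (@inordK p p)//.
by rewrite eqxx close.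
Qed.

End grid.

Lemma bounded_rec_all W b (r : R) ws prev l : (forall l i j, `|W l i j| <= r) ->
  (forall l i, `|b l i| <= r) -> bounded_rec W b r prev ws l.
Proof. by move=> hW hb; elim: ws prev l => //= n ws IH prev l. Qed.

Definition grid_net (d : nat) (a : seq nat) (Rr D delta : R)
    (k : grid_index (nparams a) Rr delta) (x : 'I_d -> R) : R :=
  clip D (realization a (gridW k) (gridb k) x).

(** The constant has [1 + Rr] in place of [Rr] because the perturbation bound wants a parameter
    bound of at least 1, while [Rr] may be small. *)
Lemma grid_net_cover (u v Rr D delta : R) d a (f : ('I_d -> R) -> R) :
  arch d a -> 0 < Rr -> 0 < D -> 0 < delta -> NetClass u v a Rr D f ->
  exists k, forall x, cube u v x -> `|f x - @grid_net d a Rr D delta k x| <=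
    delta * (1 + `|u| + `|v|) * (2 * (nparams a).+1%:R * (1 + Rr)) ^+ nparams a.
Proof.
move=> ha R0 D0 d0 [W [b [hW hf]]]; exists (grid_of (nparams a) Rr delta W b) => x cx.
rewrite hf// (le_trans (clip_lip _ _ D0))//.
have [h1 h2 h3 h4] := nparams_bounds ha.
have hh : head 0%N a = d by case: ha => _ [].
have R1 : Rr <= 1 + Rr by lra.
apply: (@realization_diff u v) => //; [lra|exact: ltW| | | |].
- apply: (bounded_rec_imp (p := nparams a)) hW => //; first by rewrite hh.
  + by move=> *; exact: le_trans R1.
  + by move=> *; exact: le_trans R1.
- apply: bounded_rec_all => *; apply: le_trans R1.
  + exact: gridW_bounded.
  + exact: gridb_bounded.
- apply: (bounded_rec_imp (p := nparams a)) hW => //; first by rewrite hh.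
  + move=> l i j /andP[_ lp] ip jp hW; apply: gridW_close => //.
    by rewrite -ltnS (leq_trans lp)// add1n ltnS.
  + move=> l i /andP[_ lp] ip hW; apply: gridb_close => //.
    by rewrite -ltnS (leq_trans lp)// add1n ltnS.
- by move=> i; rewrite subrr normr0 mulr_ge0 ?(ltW d0)// !addr_ge0.
Qed.

Lemma net_class_lip (u v Rr D : R) d a (f : ('I_d -> R) -> R) :
  arch d a -> 0 < Rr -> 0 < D -> NetClass u v a Rr D f ->
  exists2 L : R, 0 <= L & forall x x' e, 0 <= e -> cube u v x -> cube u v x' ->
    (forall j, `|x j - x' j| <= e) -> `|f x - f x'| <= L * e.
Proof.
move=> ha R0 D0 [W [b [hW hf]]].
have U0 : 0 < 1 + `|u| + `|v| by rewrite -addrA ltr_pwDl// addr_ge0.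
have [h1 h2 h3 h4] := nparams_bounds ha.
have hh : head 0%N a = d by case: ha => _ [].
exists ((2 * (nparams a).+1%:R * (1 + Rr)) ^+ nparams a).
  by rewrite exprn_ge0// !mulr_ge0//; lra.
move=> x x' e e0 cx cx' xx'; rewrite !hf// (le_trans (clip_lip _ _ D0))//.
(* The parameters coincide, so [delta] is free; [e / (1 + |u| + |v|)] makes the allowed input error
   equal to [e]. *)
rewrite mulrC -{1}(divfK (lt0r_neq0 U0) e).
have hW1 : param_bounded a W b (1 + Rr).
  apply: (bounded_rec_imp (p := nparams a)) hW => //; first by rewrite hh.
    by move=> *; apply: (@le_trans _ _ Rr) => //; lra.
  by move=> *; apply: (@le_trans _ _ Rr) => //; lra.
apply: (@realization_diff u v) => //; [lra|by rewrite divr_ge0// ltW| |].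
- by apply: bounded_rec_all => *; rewrite subrr normr0 divr_ge0// ltW.
- by move=> j; rewrite divfK ?lt0r_neq0.
Qed.

End nets.

(** * Moments of the coordinates and of [phi(Y)] *)

Section moments.
Variable R : realType.

Lemma exprn_sum_le d q (a : 'I_d -> R) : (0 < d)%N -> (forall i, 0 <= a i) ->
  (\sum_i a i) ^+ q <= d%:R ^+ q * \sum_i a i ^+ q.
Proof.
case: d a => // d a _ a0.
have [i _ ia] := @Order.TotalTheory.arg_maxP _ _ _ ord0 predT a isT.
have h : \sum_i a i <= d.+1%:R * a i.
  rewrite mulr_natl -[d.+1 in leRHS]card_ord -sumr_const.
  by apply: ler_sum => j _; exact: ia.
apply: (@le_trans _ _ ((d.+1%:R * a i) ^+ q)).
  by rewrite lerXn2r ?nnegrE ?sumr_ge0// mulr_ge0.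
rewrite exprMn ler_wpM2l ?exprn_ge0// (bigD1 i)//= lerDl.
by apply: sumr_ge0 => j _; rewrite exprn_ge0.
Qed.

Context (dO : measure_display) (Omega : measurableType dO) (P : probability Omega R).

(** Slicing at the levels [expR n] suits the tail: it becomes [2 * expR (- c1 n^2)], which beats the
    growth [expR (k (n + 1))] of the slice. The bound involves only [k] and [c1], hence is uniform
    in [d] and in the coordinate. *)
Lemma moment_le (Y : Omega -> R) (c1 : R) (k : nat) : measurable_fun setT Y -> 0 < c1 ->
  (forall t : R, 1 <= t -> Pr P [set w | t <= `|Y w|] <= 2 * expR (- c1 * (ln t) ^+ 2)) ->
  (\int[P]_w (`|Y w| ^+ k)%:E
   <= (1 + 4 * expR (k%:R + (k%:R + 1) ^+ 2 / (4 * c1)))%:E)%E.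
Proof.
move=> mY c10 tail.
pose A n := [set w | expR n%:R <= `|Y w|].
have mA n : measurable (A n).
  rewrite -[A n]setTI; apply: measurable_fun_le => //.
  exact: measurableT_comp.
pose f n w := ((expR (k%:R * n.+1%:R))%:E * (\1_(A n) w)%:E)%E : \bar R.
have f0 n w : (0 <= f n w)%E by rewrite mule_ge0 ?lee_fin// expR_ge0.
have mf n : measurable_fun setT (f n).
  by apply: measurable_funeM; apply/measurable_EFinP; exact: measurable_indic.
have mYk : measurable_fun setT (fun w => (`|Y w| ^+ k)%:E).
  apply/measurable_EFinP; apply: measurable_funX.
  exact: measurableT_comp.
have ms : measurable_fun setT (fun w => \sum_(n <oo) f n w)%E.
  exact: ge0_emeasurable_sum.
apply: (@le_trans _ _ (\int[P]_w (1%:E + \sum_(n <oo) f n w))%E).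
  apply: ge0_le_integral => //.
  - exact: emeasurable_funD.
  - move=> w _; have [Y1|Y1] := leP `|Y w| 1.
      apply: (@le_trans _ _ 1%:E); first by rewrite lee_fin exprn_ile1.
      by rewrite leeDl// nneseries_ge0.
    pose n := Num.truncn (ln `|Y w|).
    have l0 : 0 <= ln `|Y w| by rewrite ln_ge0// ltW.
    have /andP[n1 n2] := truncn_itv l0.
    have Y0 : `|Y w| \in Num.pos by rewrite posrE; lra.
    have h1 : expR n%:R <= `|Y w| by rewrite -[leRHS](lnK Y0) ler_expR.
    have h2 : `|Y w| <= expR n.+1%:R by rewrite -[leLHS](lnK Y0) ler_expR ltW.
    apply: (@le_trans _ _ (f n w)).
      rewrite /f indicE mem_set//= mule1 lee_fin expRM_natl lerXn2r ?nnegrE ?expR_ge0//.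
    apply: (@le_trans _ _ (\sum_(0 <= i < n.+1) f i w)%E).
      by rewrite big_nat_recr//= leeDr// sume_ge0.
    apply: (@le_trans _ _ (\sum_(n <oo) f n w)%E); first exact: nneseries_lim_ge.
    by rewrite leeDr.
rewrite ge0_integralD//; last by move=> w _; exact: nneseries_ge0.
rewrite integral_cst//= probability_setT mule1 EFinD leeD2l//.
rewrite integral_nneseries//.
(* The terms are compared with [C / 2^(n+1)], whose sum is [C]; the factor [2^(n+1) <= 2 expR n] is
   why [k + 1] replaces [k] in the completed square. *)
set C := 4 * _.
apply: (@le_trans _ _ (\sum_(n <oo) (C / (2 ^ n.+1)%:R)%:E)%E); last first.
  by apply: epsilon_trick0; rewrite mulr_ge0// expR_ge0.
apply: lee_nneseries => [n _ _|n _]; first exact: integral_ge0.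
rewrite integralZl//; last exact: integrable_indic.
rewrite integral_indic// setIT.
have PA : (P (A n) <= (2 * expR (- c1 * n%:R ^+ 2))%:E)%E.
  rewrite -[P (A n)]fineK ?fin_num_measure// lee_fin.
  have e1 : 1 <= expR n%:R :> R by rewrite -[leLHS]expR0 ler_expR.
  by have := tail _ e1; rewrite expRK.
apply: (le_trans (lee_wpmul2l _ PA)); first by rewrite lee_fin expR_ge0.
rewrite -EFinM lee_fin mulrCA -expRD.
have h2 : (2 ^ n.+1)%:R <= 2 * expR n%:R :> R.
  rewrite expnS natrM ler_wpM2l// natrX -[X in expR X]mulr1 expRM_natl.
  by rewrite lerXn2r ?nnegrE ?expR_ge0// (le_trans _ (expR_ge1Dx _)).
rewrite ler_pdivlMr ?ltr0n ?expn_gt0//.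
apply: (le_trans (ler_wpM2l _ h2)); first by rewrite mulr_ge0// expR_ge0.
rewrite mulrACA -expRD /C (_ : 2 * 2 = 4); last by rewrite -natrM.
rewrite ler_wpM2l// ler_expR.
(* completing the square: [(k+1) n - c1 n^2 <= (k+1)^2 / (4 c1)] *)
have sq : 0 <= c1 * (n%:R - (k%:R + 1) / (2 * c1)) ^+ 2.
  by rewrite mulr_ge0 ?sqr_ge0// ltW.
have -> : k%:R + (k%:R + 1) ^+ 2 / (4 * c1) =
  k%:R + (k%:R + 1) * n%:R - c1 * n%:R ^+ 2 + c1 * (n%:R - (k%:R + 1) / (2 * c1)) ^+ 2.
  by field; rewrite gt_eqF.
rewrite -natr1; lra.
Qed.

Lemma powR_le_exprn (x lam : R) q : 0 <= x -> 0 <= lam -> lam <= q%:R ->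
  x `^ lam <= 1 + x ^+ q.
Proof.
move=> x0 l0 lq; have [x1|x1] := leP x 1.
  apply: (@le_trans _ _ 1); last by rewrite lerDl exprn_ge0.
  have <- : 1 `^ lam = 1 :> R by rewrite powR1.
  by rewrite ge0_ler_powR ?nnegrE.
apply: (@le_trans _ _ (x ^+ q)); last by rewrite lerDr.
by rewrite -powR_mulrn// ler_powR// ltW.
Qed.

Lemma norm2_ge0 n (y : 'I_n -> R) : 0 <= norm2 y.
Proof. exact: sqrtr_ge0. Qed.

(** The exponent [2 q] is even, so the root in [norm2] disappears. A power [d^q] comes from the
    [q]-th power of a sum of [d] squares, one more [d] from summing [d] moments. *)
Lemma second_moment_le d q (Y : Omega -> 'I_d -> R) (phi : ('I_d -> R) -> R)
    (c1 c2 lam : R) :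
  (0 < d)%N -> rvec Y -> measurable_fun setT (fun w => phi (Y w)) -> 0 < c1 ->
  (forall (t : R) (i : 'I_d), 1 <= t ->
     Pr P [set w | t <= `|Y w i|] <= 2 * expR (- c1 * (ln t) ^+ 2)) ->
  0 < c2 -> 0 <= lam -> lam <= q%:R ->
  (forall y, `|phi y| <= c2 * (1 + norm2 y `^ lam)) ->
  (\int[P]_w (phi (Y w) ^+ 2)%:E <= (2 * c2 ^+ 2 * (4 + d%:R ^+ q.+1 *
     (1 + 4 * expR ((2 * q)%:R + ((2 * q)%:R + 1) ^+ 2 / (4 * c1)))))%:E)%E.
Proof.
move=> d0 mY mphi c10 tail c20 l0 lq hphi; set M := 1 + 4 * _.
have pointwise y : phi y ^+ 2 <= 2 * c2 ^+ 2 * (4 + d%:R ^+ q * \sum_j `|y j| ^+ (2 * q)).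
  have N0 := norm2_ge0 y; set N := norm2 y in N0 *.
  have h1 : `|phi y| <= c2 * (2 + N ^+ q).
    apply: (le_trans (hphi y)); rewrite ler_wpM2l ?(ltW c20)//.
    by have := powR_le_exprn N0 l0 lq; lra.
  have h2 : phi y ^+ 2 <= (c2 * (2 + N ^+ q)) ^+ 2.
    rewrite -[leLHS]real_normK ?num_real// lerXn2r ?nnegrE//.
    exact: le_trans (normr_ge0 _) h1.
  apply: (le_trans h2); rewrite exprMn (mulrC 2) -(mulrA (c2 ^+ 2)) ler_wpM2l ?sqr_ge0//.
  apply: (@le_trans _ _ (2 * (4 + (N ^+ q) ^+ 2))).
    have := sqr_ge0 (2 - N ^+ q); lra.
  rewrite ler_wpM2l// lerD2l -exprM mulnC exprM /N /norm2 sqr_sqrtr; last first.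
    by apply: sumr_ge0 => j _; exact: sqr_ge0.
  apply: (le_trans (exprn_sum_le _ d0 _)); first by move=> j; exact: sqr_ge0.
  rewrite le_eqVlt; apply/orP; left; apply/eqP; congr (_ * _).
  by apply: eq_bigr => j _; rewrite exprM real_normK ?num_real.
have mYj j : measurable_fun setT (fun w => (`|Y w j| ^+ (2 * q))%:E).
  apply/measurable_EFinP; apply: measurable_funX.
  by apply: measurableT_comp => //; exact: mY.
pose F w := ((2 * c2 ^+ 2)%:E * (4%:E + (d%:R ^+ q)%:E * \sum_j (`|Y w j| ^+ (2 * q))%:E))%E.
have c22 : (0 <= (2 * c2 ^+ 2)%:E)%E by rewrite lee_fin mulr_ge0// sqr_ge0.
have S0 w : (0 <= \sum_j (`|Y w j| ^+ (2 * q))%:E)%E.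
  by apply: sume_ge0 => j _; rewrite lee_fin exprn_ge0.
have dq0 : (0 <= (d%:R ^+ q)%:E :> \bar R)%E by rewrite lee_fin exprn_ge0.
have mS : measurable_fun setT (fun w => \sum_j (`|Y w j| ^+ (2 * q))%:E)%E.
  exact: emeasurable_sum.
have mdS : measurable_fun setT
    (fun w => (d%:R ^+ q)%:E * \sum_j (`|Y w j| ^+ (2 * q))%:E)%E.
  exact: measurable_funeM.
have mI : measurable_fun setT
    (fun w => 4%:E + (d%:R ^+ q)%:E * \sum_j (`|Y w j| ^+ (2 * q))%:E)%E.
  exact: emeasurable_funD.
apply: (@le_trans _ _ (\int[P]_w F w)%E).
  apply: ge0_le_integral => //.
  - by move=> w _; rewrite lee_fin sqr_ge0.
  - by apply/measurable_EFinP; exact: measurable_funX.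
  - exact: measurable_funeM.
  - move=> w _; rewrite /F sumEFin; exact: (pointwise (Y w)).
rewrite ge0_integralZl//; last by move=> w _; rewrite adde_ge0// mule_ge0.
rewrite [X in (_ <= X)%E]EFinM lee_wpmul2l// ge0_integralD//; last by move=> w _; rewrite mule_ge0.
rewrite integral_cst//= probability_setT mule1 [X in (_ <= X)%E]EFinD leeD2l//.
rewrite ge0_integralZl// exprSr -mulrA [X in (_ <= X)%E]EFinM lee_wpmul2l//.
rewrite ge0_integral_sum//.
apply: (@le_trans _ _ (\sum_(j < d) M%:E)%E).
  by apply: lee_sum => j _; apply: moment_le => // t t1; exact: tail.
by rewrite sumEFin lee_fin sumr_const card_ord mulr_natl.
Qed.

End moments.

(** * Borel structure on vectors and measurability of networks *)

Section measurability.
Variable R : realType.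

(** A measurable type whose measurable sets are [borelRn] by definition, so that [same_law] and
    [mutually_indep] feed the abstract sample lemmas directly. *)
Definition Rn (n : nat) := g_sigma_algebraType (@cylRn R n).
HB.instance Definition _ n := Measurable.on (Rn n).

Lemma borel_funP n (g : ('I_n -> R) -> R) :
  borel_fun g -> measurable_fun setT (g : Rn n -> R).
Proof. by move=> mg _ B mB; rewrite setTI; exact: mg. Qed.

Lemma measurable_coord n (j : 'I_n) : measurable_fun setT (fun x : Rn n => x j).
Proof.
move=> _ B mB; rewrite setTI; apply: sub_sigma_algebra.
by exists j, B.
Qed.

Context (dT : measure_display) (T : measurableType dT).

Lemma measurable_rvec n (V : T -> 'I_n -> R) :
  (forall j, measurable_fun setT (fun w => V w j)) ->
  measurable_fun setT (V : T -> Rn n).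
Proof.
move=> mV; apply: (@measurability _ _ T (Rn n) setT V (@cylRn R n)) => //.
move=> _ [B [j [C [mC ->]]] <-].
exact: mV.
Qed.

Lemma measurable_netrec (W : nat -> nat -> nat -> R) b prev ws l (z : T -> nat -> R) :
  (forall j, measurable_fun setT (fun w => z w j)) ->
  forall i, measurable_fun setT (fun w => netrec W b prev ws l (z w) i).
Proof.
elim: ws prev l z => // n ws IH prev l z mz i.
have ma j : measurable_fun setT (fun w => affine W b l prev (z w) j).
  apply: measurable_funD => //; apply: measurable_sum => k.
  exact: measurable_funM.
case: ws IH => [|n' ws] IH //=.
by apply: IH => j; apply: measurable_maxr.
Qed.

Lemma measurable_realization d (a : seq nat) (W : nat -> nat -> nat -> R) b (X : T -> 'I_d -> R) :
  (forall j, measurable_fun setT (fun w => X w j)) ->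
  measurable_fun setT (fun w => realization a W b (X w)).
Proof.
move=> mX; apply: measurable_netrec => j.
by rewrite /vext; case: (insub j : option 'I_d) => [i|] /=; [exact: mX|].
Qed.

End measurability.

(** * Measurability of the risk of a random function *)

Section risk.
Context (R : realType) (dO : measure_display) (Omega : measurableType dO)
  (P : probability Omega R).
Variables (u v : R) (d : nat) (X : Omega -> 'I_d -> R) (xi : Omega -> R).
Hypotheses (mX : rvec X) (cX : forall w, cube u v (X w)).
Hypothesis mxi : measurable_fun setT xi.
Variables (F : Omega -> ('I_d -> R) -> R).
Hypothesis mF : forall x, cube u v x -> measurable_fun setT (F ^~ x).
Hypothesis F_lip : forall w, exists2 L : R, 0 <= L & forall x x' e, 0 <= e ->
  cube u v x -> cube u v x' -> (forall j, `|x j - x' j| <= e) ->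
  `|F w x - F w x'| <= L * e.


(** [G n] replaces [X] by its lower node on a grid of mesh [1 / (n + 1)]; it is a finite sum of
    products of measurable functions and converges pointwise by the Lipschitz bound. Rounding down
    on a grid based at [u] never leaves the cube. *)
Lemma measurable_caratheodory :
  measurable_fun setT (fun ww : Omega * Omega => F ww.1 (X ww.2)).
Proof.
pose step n : R := n.+1%:R^-1.
have step0 n : 0 < step n by rewrite invr_gt0.
pose rnd n (x : 'I_d -> R) : 'I_d -> R :=
  fun j => qlevel (- u) (step n) (qindex (- u) (step n) (x j)).
have rndP n x : cube u v x -> forall j, rnd n x j <= x j < rnd n x j + step n.
  move=> cx j; apply: qlevel_qindex => //; rewrite opprK.
  by case/andP: (cx j).
have cube_rnd n x : cube u v x -> cube u v (rnd n x).
  move=> cx j; have /andP[rx _] := rndP n x cx j; have /andP[ux xv] := cx j.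
  rewrite (le_trans rx xv) andbT /rnd /qlevel opprK lerDr.
  by rewrite mulr_ge0// ltW.
pose N n := Num.truncn ((v - u) / step n).
pose node n (k : {ffun 'I_d -> 'I_(N n).+1}) : 'I_d -> R :=
  fun j => qlevel (- u) (step n) (k j).
pose cell n (k : {ffun 'I_d -> 'I_(N n).+1}) : set Omega :=
  \bigcap_(j in [set: 'I_d]) [set w | node n k j <= X w j < node n k j + step n].
have mcell n k : measurable (cell n k).
  apply: fin_bigcap_measurable => // j _.
  rewrite (_ : [set w | _] = (fun w => X w j) @^-1` `[node n k j, node n k j + step n[).
    by rewrite -[X in measurable X]setTI; apply: mX.
  by apply/seteqP; split=> w /=; rewrite in_itv.
pose idx n w : {ffun 'I_d -> 'I_(N n).+1} :=
  [ffun j => inord (qindex (- u) (step n) (X w j))].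
have idxE n w j : idx n w j = qindex (- u) (step n) (X w j) :> nat.
  rewrite ffunE inordK// ltnS; apply: le_truncn.
  by rewrite ler_wpM2r ?invr_ge0 ?(ltW (step0 n))// lerB//; case/andP: (cX w j).
have cellE n w k : cell n k w <-> idx n w = k.
  split=> [ck|<- j _ /=]; last first.
    by rewrite /node idxE; exact: rndP.
  apply/ffunP => j; apply/val_inj => /=; rewrite idxE; apply/eqP.
  rewrite qindexP//; first exact: ck.
  by rewrite opprK; case/andP: (cX w j).
pose G n (ww : Omega * Omega) : R :=
  \sum_k F ww.1 (node n k) * \1_(cell n k) ww.2.
have GE n ww : G n ww = F ww.1 (rnd n (X ww.2)).
  rewrite /G (bigD1 (idx n ww.2))//= [X in _ + X]big1 ?addr0 => [|k kn].
    rewrite indicE mem_set ?mulr1; last exact/cellE.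
    by congr F; apply/funext => j; rewrite /node idxE.
  by rewrite indicE memNset ?mulr0// => /cellE/esym/eqP; exact/negP.
apply: (measurable_fun_cvg (h := G)) => [n|ww _].
  apply: measurable_sum => k.
  (* Measurability of [F] is known only at points of the cube; a node outside would have an empty
     cell, so its term vanishes. *)
  have [cn|cn] := pselect (cube u v (node n k)).
    apply: measurable_funM.
      by apply: (measurableT_comp (mF cn)); exact: measurable_fst.
    have mi : measurable_fun setT (\1_(cell n k) : Omega -> R) by exact: measurable_indic.
    exact: (measurableT_comp mi measurable_snd).
  suff -> : (fun x : Omega * Omega => F x.1 (node n k) * \1_(cell n k) x.2) = cst 0 by [].
  apply/funext => x /=; rewrite indicE memNset ?mulr0// => /cellE xk; apply: cn.
  suff -> : node n k = rnd n (X x.2) by exact: cube_rnd.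
  by apply/funext => j; rewrite /node -xk idxE.
have [L L0 HL] := F_lip ww.1.
have L1 : 0 < L + 1 by lra.
apply/cvgrPdist_le => /= e e0; near=> n.
rewrite GE (le_trans (HL _ _ (step n) _ _ _ _))//; [exact: ltW|exact: cube_rnd| |].
  move=> j; have /andP[r1 r2] := rndP n _ (cX ww.2) j.
  by rewrite ger0_norm ?subr_ge0//; lra.
have sn : step n < e / (L + 1).
  by near: n; exact: (near_infty_natSinv_lt (PosNum (divr_gt0 e0 L1))).
apply: (@le_trans _ _ ((L + 1) * step n)).
  by rewrite ler_wpM2r ?(ltW (step0 n))//; lra.
by rewrite mulrC -ler_pdivlMr// ltW.
Unshelve. all: by end_near.
Qed.

(** Tonelli on [Omega * Omega]: the first coordinate selects the function, the second is integrated
    out. A nonnegative integrand needs no integrability. *)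
Lemma measurable_risk (c : \bar R) :
  measurable [set w | (\int[P]_w' ((F w (X w') - xi w') ^+ 2)%:E <= c)%E].
Proof.
rewrite -[X in measurable X]setTI; apply: emeasurable_fun_infty_c => //.
apply: (@measurable_fun_fubini_tonelli_F _ _ _ _ _ P
  (fun ww : Omega * Omega => ((F ww.1 (X ww.2) - xi ww.2) ^+ 2)%:E)).
- apply/measurable_EFinP; apply: measurable_funX; apply: measurable_funB.
    exact: measurable_caratheodory.
  by apply: measurableT_comp => //; exact: measurable_snd.
- by move=> ww; rewrite lee_fin sqr_ge0.
Qed.

End risk.

(** * Scalar inequalities for the cross loss *)

Section scalar_bounds.
Variable R : realType.

(** Beyond [K] the excess is at most [|x| <= x^2 / K]; a second moment thereby yields a first moment
    of order [1 / K]. *)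
Lemma clip_tail_le (K x : R) : 0 < K -> `|x - clip K x| <= x ^+ 2 / K.
Proof.
move=> K0; rewrite ler_pdivlMr//; have [h|h] := leP `|x| K.
  have -> : clip K x = x by rewrite /clip min_l// mulr_sg_norm.
  by rewrite subrr normr0 mul0r sqr_ge0.
have -> : x - clip K x = Num.sg x * (`|x| - K).
  rewrite /clip min_r ?(ltW h)// mulrBr; congr (_ - _).
  by rewrite mulr_sg_norm.
have p0 : 0 < `|x| by lra.
rewrite normrM normr_sg (_ : x != 0)//= ?mul1r; last by rewrite -normr_gt0.
rewrite -[X in _ <= X]real_normK ?num_real// (@ger0_norm _ (`|x| - K)); last lra.
by move: `|x| h p0 => t h p0; nra.
Qed.

Lemma ler_1Dsqr (x : R) : x <= 1 + x ^+ 2.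
Proof. have := sqr_ge0 (x - 2^-1); lra. Qed.

Lemma sqr_cross_le (a y D K : R) : `|a| <= D -> `|y| <= K -> 0 <= D -> 0 <= K ->
  `|a ^+ 2 - 2 * (a * y)| <= (D + K) ^+ 2.
Proof.
move=> aD yK D0 K0; rewrite (le_trans (ler_normB _ _))//.
rewrite normrX !normrM (@ger0_norm _ 2)//.
have h3 : `|a| * `|y| <= D * K by rewrite ler_pM.
have h4 : `|a| ^+ 2 <= D ^+ 2 by rewrite lerXn2r ?nnegrE.
have h5 := sqr_ge0 K; lra.
Qed.

Lemma cross_truncation (a y y' D : R) : `|a| <= D ->
  `|(a ^+ 2 - 2 * (a * y)) - (a ^+ 2 - 2 * (a * y'))| <= 2 * D * `|y - y'|.
Proof.
move=> aD; have -> : (a ^+ 2 - 2 * (a * y)) - (a ^+ 2 - 2 * (a * y')) = - (2 * (a * (y - y'))).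
  by ring.
by rewrite normrN !normrM (@ger0_norm _ 2)// -mulrA ler_wpM2l// ler_wpM2r.
Qed.

Lemma cross_approx (a a' y D K eta : R) :
  `|a| <= D -> `|a'| <= D -> `|y| <= K -> `|a - a'| <= eta ->
  `|(a ^+ 2 - 2 * (a * y)) - (a' ^+ 2 - 2 * (a' * y))| <= 2 * eta * (D + K).
Proof.
move=> aD aD' yK aa.
have -> : (a ^+ 2 - 2 * (a * y)) - (a' ^+ 2 - 2 * (a' * y)) = (a - a') * (a + a' - 2 * y).
  by ring.
rewrite normrM (_ : 2 * eta * _ = eta * (2 * (D + K))); last by ring.
rewrite ler_pM// (le_trans (ler_normB _ _))// normrM (@ger0_norm _ 2)//.
by have := ler_normD a a'; lra.
Qed.

Lemma sqrD_le (D t : R) : (D + t) ^+ 2 <= 2 * (1 + D ^+ 2) * (1 + t ^+ 2).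
Proof.
have h := sqr_ge0 (D - t); have h1 := mulr_ge0 (sqr_ge0 D) (sqr_ge0 t).
lra.
Qed.

Lemma dist_le_of_lt (n E T e : R) :
  - T < n * (- E + e) -> T < n * (E + e) -> `|n * E - T| <= n * e.
Proof. by move=> h1 h2; rewrite ler_norml; apply/andP; split; lra. Qed.

End scalar_bounds.

(** * Uniform deviation of the cross loss *)

Section uniform_deviation.
Context (R : realType) (dO dS : measure_display) (Omega : measurableType dO)
  (S : measurableType dS) (P : probability Omega R).
Variables (V : nat -> Omega -> S) (V0 : Omega -> S).
Hypothesis mV : forall i, measurable_fun setT (V i).
Hypothesis mV0 : measurable_fun setT V0.
Hypothesis V_law : forall i A, measurable A -> P (V i @^-1` A) = P (V0 @^-1` A).
Hypothesis V_indep : forall (s : seq nat) (A : nat -> set S), uniq s ->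
  (forall i, measurable (A i)) ->
  Pr P (\bigcap_(i in [set i | i \in s]) (V i @^-1` A i)) =
  \prod_(i <- s) Pr P (V i @^-1` A i).

Variables (D K M eta : R) (psi : S -> R).
Hypotheses (D_gt0 : 0 < D) (K_ge1 : 1 <= K).
Hypothesis mpsi : measurable_fun setT psi.
Hypothesis psi2 : (\int[P]_w (psi (V0 w) ^+ 2)%:E <= M%:E)%E.

Let K_gt0 : 0 < K. Proof. exact: lt_le_trans ltr01 K_ge1. Qed.

Let psiK z := clip K (psi z).
Let tail z : R := `|psi z - psiK z|.

(* The squared loss without its [psi ^+ 2] part, which does not depend on [f]. *)
Definition cross_loss (y f : S -> R) z := f z ^+ 2 - 2 * (f z * y z).

Let mpsiK : measurable_fun setT psiK.
Proof. by apply: measurableT_comp => //; exact: measurable_clip. Qed.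

Let mtail : measurable_fun setT tail.
Proof. by apply: measurableT_comp => //; exact: measurable_funB. Qed.

Let tail_ge0 z : 0 <= tail z. Proof. exact: normr_ge0. Qed.

Let tail_le z : tail z <= psi z ^+ 2 / K.
Proof. exact: clip_tail_le. Qed.

Lemma dominated_integrable (h : S -> R) (c : R) : measurable_fun setT h -> 0 <= c ->
  (forall z, `|h z| <= c * (1 + psi z ^+ 2)) -> P.-integrable setT (EFin \o (h \o V0)).
Proof.
move=> mh c0 hc.
have mh0 : measurable_fun setT (h \o V0) by exact: measurableT_comp.
have mp2 : measurable_fun setT (fun w => (psi (V0 w) ^+ 2)%:E).
  by apply/measurable_EFinP; apply: measurable_funX; exact: (measurableT_comp mpsi).
have mb : measurable_fun setT (fun w => 1%:E + (psi (V0 w) ^+ 2)%:E)%E.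
  exact: emeasurable_funD.
have p20 w : (0 <= (psi (V0 w) ^+ 2)%:E)%E by rewrite lee_fin sqr_ge0.
have b0 w : (0 <= 1%:E + (psi (V0 w) ^+ 2)%:E)%E by rewrite adde_ge0.
apply/integrableP; split; first exact/measurable_EFinP.
apply: (@le_lt_trans _ _ (c%:E * (1 + M)%:E)%E); last exact: ltry.
apply: (@le_trans _ _ (\int[P]_w (c%:E * (1%:E + (psi (V0 w) ^+ 2)%:E)))%E).
  apply: ge0_le_integral => //.
  - by apply: measurableT_comp => //; exact/measurable_EFinP.
  - exact: measurable_funeM.
  - by move=> w _; exact: (hc (V0 w)).
rewrite ge0_integralZl// lee_wpmul2l// ge0_integralD//.
by rewrite integral_cst//= probability_setT mule1 EFinD leeD2l.
Qed.

Let tail_int_le : (\int[P]_w (tail (V0 w))%:E <= (M / K)%:E)%E.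
Proof.
apply: (@le_trans _ _ (\int[P]_w ((K^-1)%:E * (psi (V0 w) ^+ 2)%:E))%E).
  apply: ge0_le_integral => //.
  - by move=> w _; rewrite lee_fin tail_ge0.
  - by apply/measurable_EFinP; exact: (measurableT_comp mtail).
  - apply: measurable_funeM; apply/measurable_EFinP; apply: measurable_funX.
    exact: (measurableT_comp mpsi).
  - by move=> w _; rewrite -EFinM lee_fin mulrC tail_le.
rewrite ge0_integralZl//; last 3 first.
- apply/measurable_EFinP; apply: measurable_funX; exact: (measurableT_comp mpsi).
- by move=> w _; rewrite lee_fin sqr_ge0.
- by rewrite lee_fin invr_ge0 ltW.
by rewrite mulrC EFinM lee_wpmul2l// lee_fin invr_ge0 ltW.
Qed.

Let tail_integrable : P.-integrable setT (EFin \o (tail \o V0)).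
Proof.
apply: (@dominated_integrable _ K^-1) => // [|z]; first by rewrite invr_ge0 ltW.
rewrite normr_id mulrC (le_trans (tail_le z))// ler_wpM2r ?invr_ge0 ?(ltW K_gt0)//.
by rewrite lerDr.
Qed.

Let tail_mean : (\int[P]_w tail (V0 w))%R <= M / K.
Proof.
rewrite -lee_fin /Rintegral fineK//.
exact: (integrable_fin_num measurableT tail_integrable).
Qed.

Let cross_bounded (f : S -> R) : (forall z, `|f z| <= D) -> forall z,
  `|cross_loss psiK f z| <= (D + K) ^+ 2.
Proof.
by move=> fD z; apply: sqr_cross_le => //; [exact: clip_bounded|exact: ltW|exact: ltW].
Qed.

Let cross_measurable (y f : S -> R) : measurable_fun setT y -> measurable_fun setT f ->
  measurable_fun setT (cross_loss y f).
Proof.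
move=> my mf; apply: measurable_funB; first exact: measurable_funX.
by apply: measurable_funM => //; exact: measurable_funM.
Qed.

Lemma cross_integrable (f : S -> R) : measurable_fun setT f -> (forall z, `|f z| <= D) ->
  P.-integrable setT (EFin \o (cross_loss psi f \o V0)).
Proof.
move=> mf fD; apply: (@dominated_integrable _ (2 * (1 + D ^+ 2))) => [|//|z].
- exact: cross_measurable.
- by rewrite mulr_ge0// addr_ge0// sqr_ge0.
apply: le_trans (sqr_cross_le (fD z) (lexx `|psi z|) (ltW D_gt0) (normr_ge0 _)) _.
rewrite -(@real_normK _ (psi z)) ?num_real//; exact: sqrD_le.
Qed.

Lemma risk_decomposition (f : S -> R) : measurable_fun setT f -> (forall z, `|f z| <= D) ->
  (\int[P]_w ((f (V0 w) - psi (V0 w)) ^+ 2)%:E =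
   ((\int[P]_w cross_loss psi f (V0 w))%R)%:E + \int[P]_w (psi (V0 w) ^+ 2)%:E)%E.
Proof.
move=> mf fD; have i1 := cross_integrable mf fD.
have i2 : P.-integrable setT (EFin \o ((fun z => psi z ^+ 2) \o V0)).
  apply: (@dominated_integrable _ 1) => //; first exact: measurable_funX.
  by move=> z; rewrite ger0_norm ?sqr_ge0// mul1r lerDr.
rewrite /Rintegral fineK; last exact: (integrable_fin_num measurableT i1).
rewrite -integralD_EFin//; apply: eq_integral => w _.
by rewrite -EFinD; congr EFin; rewrite /cross_loss /=; ring.
Qed.

Let crossK_integrable (f : S -> R) : measurable_fun setT f -> (forall z, `|f z| <= D) ->
  P.-integrable setT (EFin \o (cross_loss psiK f \o V0)).
Proof.
move=> mf fD; apply: (bounded_integrable P mV0 (B := (D + K) ^+ 2)).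
  exact: cross_measurable.
exact: cross_bounded.
Qed.

Section deviation.
Variables (I : finType) (g : I -> S -> R) (C : set S) (m : nat) (e1 s : R).
Hypotheses (CV0 : forall w, C (V0 w)) (CV : forall i w, C (V i w)).
Hypotheses (mg : forall k, measurable_fun setT (g k)) (gD : forall k z, `|g k z| <= D).
Hypotheses (e1_gt0 : 0 < e1) (e1_le1 : e1 <= 1) (s_gt0 : 0 < s) (m_gt0 : (0 < m)%N).

(** The sign makes the one-sided Hoeffding bound two-sided, whence the factor 2 before [#|I|]. *)
Let signed (kb : I * bool) z : R := (-1) ^+ kb.2 * cross_loss psiK (g kb.1) z.

Let msigned kb : measurable_fun setT (signed kb).
Proof. by apply: measurable_funM => //; exact: cross_measurable. Qed.

Let signed_bounded kb z : `|signed kb z| <= (D + K) ^+ 2.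
Proof. by rewrite normrMsign cross_bounded. Qed.

Let bad kb := [set w | m%:R * ((\int[P]_w signed kb (V0 w))%R + e1)
  <= \sum_(i < m) signed kb (V i w)].

Let heavy := [set w | m%:R * s <= \sum_(i < m) tail (V i w)].

Let mbad kb : measurable (bad kb).
Proof.
rewrite -[bad kb]setTI; apply: measurable_fun_le => //.
by apply: measurable_sum => i; exact: measurableT_comp.
Qed.

Let mheavy : measurable heavy.
Proof.
rewrite -[heavy]setTI; apply: measurable_fun_le => //.
by apply: measurable_sum => i; exact: (measurableT_comp mtail).
Qed.

Let approx_pointwise (f : S -> R) k z : (forall z, `|f z| <= D) -> C z ->
  (forall z, C z -> `|f z - g k z| <= eta) ->
  `|cross_loss psi f z - cross_loss psiK (g k) z| <= 2 * D * tail z + 2 * eta * (D + K).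
Proof.
move=> fD Cz fg.
apply: le_trans (ler_distD (cross_loss psiK f z) _ _) _; apply: lerD.
  exact: cross_truncation.
by apply: cross_approx => //; [exact: clip_bounded | exact: fg].
Qed.

Let approx_mean (f : S -> R) k : measurable_fun setT f -> (forall z, `|f z| <= D) ->
  (forall z, C z -> `|f z - g k z| <= eta) ->
  `|(\int[P]_w cross_loss psi f (V0 w))%R - (\int[P]_w cross_loss psiK (g k) (V0 w))%R|
  <= 2 * D * (M / K) + 2 * eta * (D + K).
Proof.
move=> mf fD fg.
have i1 := cross_integrable mf fD.
have i2 := crossK_integrable (mg k) (gD k).
have i3 : P.-integrable setT
    (EFin \o (fun w => cross_loss psi f (V0 w) - cross_loss psiK (g k) (V0 w))).
  exact: (integrableB measurableT i1 i2).
rewrite -RintegralB//; apply: le_trans (le_normr_Rintegral _ i3) _ => //.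
have it : P.-integrable setT (EFin \o (fun w => 2 * D * tail (V0 w))).
  exact: (integrableZl measurableT (2 * D) tail_integrable).
have ic : P.-integrable setT (EFin \o (fun=> 2 * eta * (D + K)) : Omega -> \bar R).
  exact: finite_measure_integrable_cst.
apply: (@le_trans _ _ (\int[P]_w (2 * D * tail (V0 w) + 2 * eta * (D + K)))%R).
  apply: le_Rintegral => //.
  - exact: integrable_norm.
  - exact: (integrableD measurableT it ic).
  - by move=> w _; apply: approx_pointwise.
rewrite RintegralD// Rintegral_probT RintegralZl// lerD2r ler_wpM2l//.
by rewrite mulr_ge0// ltW.
Qed.

(** The comparison runs from the mean for [f] to the clipped mean for [g k], then to its empirical
    sum, then to the sum for [f]. The mesh is paid at both ends, hence [4 * eta * (D + K)];
    truncation costs [M / K] in mean and [s] empirically. [G] is chosen before [f], so [f] may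
    depend on [w]. *)
Lemma uniform_deviation : exists G : set Omega,
  [/\ measurable G,
      (P (~` G) <= (2 * #|I|%:R * expR (- (m%:R * (e1 ^+ 2 / (128 * ((D + K) ^+ 2) ^+ 2))))
         + M / K / s)%:E)%E &
      forall w, G w -> forall f : S -> R, measurable_fun setT f -> (forall z, `|f z| <= D) ->
        (exists k, forall z, C z -> `|f z - g k z| <= eta) ->
        `|m%:R * (\int[P]_w cross_loss psi f (V0 w))%R
          - \sum_(i < m) cross_loss psi f (V i w)|
        <= m%:R * (2 * D * (M / K) + 4 * eta * (D + K) + e1 + 2 * D * s)].
Proof.
pose B := \big[setU/set0]_kb bad kb.
have mB : measurable B by exact: bigsetU_measurable.
exists (~` (B `|` heavy)); split; first exact/measurableC/measurableU.
- rewrite setCK (le_trans (measureU2 _ _ _))// EFinD leeD//; last first.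
    exact: markov_mean tail_int_le.
  apply: le_trans (measure_bigsetU_le P predT mbad) _.
  set x := expR _.
  apply: (@le_trans _ _ (\sum_(kb : I * bool) x%:E)%E).
    apply: lee_sum => kb _; apply: hoeffding => //.
    - by rewrite exprn_gt0// addr_gt0.
    (* [e1 <= 1 <= (D + K)^2] is the range condition of [hoeffding]. *)
    - by rewrite (le_trans e1_le1)// exprn_ege1// (le_trans K_ge1)// lerDr ltW.
  by rewrite sumEFin lee_fin sumr_const card_prod card_bool mulnC -[leLHS]mulr_natl natrM.
move=> w /not_orP[nB nF] f mf fD [k fk].
have nbad b : \sum_(i < m) signed (k, b) (V i w)
              < m%:R * ((\int[P]_w signed (k, b) (V0 w))%R + e1).
  rewrite ltNge; apply/negP => h; apply: nB.
  by rewrite /B -bigcup_pred; exists (k, b).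
have light : \sum_(i < m) tail (V i w) < m%:R * s.
  by rewrite ltNge; apply/negP => h; apply: nF.
set Ef := (\int[P]_w cross_loss psi f (V0 w))%R.
set Sf := \sum_(i < m) cross_loss psi f (V i w).
pose Eg := (\int[P]_w cross_loss psiK (g k) (V0 w))%R.
pose Sg := \sum_(i < m) cross_loss psiK (g k) (V i w).
have h1 : `|m%:R * Eg - Sg| <= m%:R * e1.
  have := nbad false; have := nbad true; rewrite /signed/= expr0 expr1.
  rewrite RintegralZl//; last exact: crossK_integrable.
  rewrite RintegralZl//; last exact: crossK_integrable.
  rewrite -!mulr_sumr -/Eg -/Sg !mulN1r !mul1r => a1 a2; exact: dist_le_of_lt.
have h2 : `|m%:R * Ef - m%:R * Eg| <= m%:R * (2 * D * (M / K) + 2 * eta * (D + K)).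
  rewrite -mulrBr normrM normr_nat ler_wpM2l//; exact: approx_mean.
have h3 : `|Sg - Sf| <= m%:R * (2 * D * s + 2 * eta * (D + K)).
  rewrite distrC /Sf /Sg -sumrB (le_trans (ler_norm_sum _ _ _))//.
  apply: (@le_trans _ _ (\sum_(i < m) (2 * D * tail (V i w) + 2 * eta * (D + K)))).
    by apply: ler_sum => i _; exact: approx_pointwise.
  rewrite big_split/= -mulr_sumr sumr_const card_ord (mulrDr m%:R) [X in _ <= _ + X]mulr_natl lerD2r.
  by rewrite mulrCA ler_wpM2l// ?mulr_ge0 ?ltW.
have -> : m%:R * Ef - Sf = (m%:R * Ef - m%:R * Eg) + ((m%:R * Eg - Sg) + (Sg - Sf)).
  by ring.
rewrite (le_trans (ler_normD _ _))//.
apply: (@le_trans _ _ (m%:R * (2 * D * (M / K) + 2 * eta * (D + K)) +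
  (m%:R * e1 + m%:R * (2 * D * s + 2 * eta * (D + K))))).
  by rewrite lerD// (le_trans (ler_normD _ _))// lerD.
rewrite -!mulrDr ler_wpM2l// le_eqVlt; apply/orP; left; apply/eqP.
by move: (M / K) => t; ring.
Qed.

End deviation.
End uniform_deviation.

(** * Polynomial functions *)

Section polynomial.
Import -(notations) mpoly.
Variables (R : realType) (n : nat).

(** Stated through evaluations, so that [h] arises from a closed formula by closure properties and
    is never expanded into monomials. *)
Definition polynomial (F : ('I_n -> R) -> R) :=
  exists h : mpoly.mpoly n R, forall x, mpoly.meval x h = F x.

Lemma polynomial_cst c : polynomial (fun=> c).
Proof. by exists (mpoly.mpolyC n c) => x; exact: mevalC. Qed.

Lemma polynomial_var i : polynomial (fun x => x i).
Proof. by exists (mpoly.mpolyX R (mpoly.mnm1 i)) => x; exact: mevalXU. Qed.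

Lemma polynomialD F G : polynomial F -> polynomial G -> polynomial (fun x => F x + G x).
Proof. by move=> [f hf] [g hg]; exists (f + g) => x; rewrite mevalD hf hg. Qed.

Lemma polynomialM F G : polynomial F -> polynomial G -> polynomial (fun x => F x * G x).
Proof. by move=> [f hf] [g hg]; exists (f * g) => x; rewrite mevalM hf hg. Qed.

Lemma polynomialX F k : polynomial F -> polynomial (fun x => F x ^+ k).
Proof.
move=> [f hf]; exists (f ^+ k) => x; elim: k => [|k IH]; first by rewrite !expr0 meval1.
by rewrite !exprS mevalM hf IH.
Qed.

End polynomial.

(** * Choice of the constants and of the sample size *)

Section sample_size.
Variable R : realType.
Implicit Types (C U eps rho D M K p l e r : R).

Lemma le_expR (x : R) : x <= expR x.
Proof. by have := expR_ge1Dx x; lra. Qed.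

(** For [x < 1] the logarithm is negative, so no bound linear in [ln x] with positive slope can
    work; its square handles both signs. *)
Lemma one_add_le_expR_sqr_ln (x : R) : 0 < x -> 1 + x <= expR (2 + ln x ^+ 2).
Proof.
move=> x0; set y := ln x; have xE : x = expR y by rewrite /y lnK// posrE.
have h1 : 1 <= expR (1 + y ^+ 2).
  by rewrite -[leLHS]expR0 ler_expR addr_ge0// sqr_ge0.
have h2 : x <= expR (1 + y ^+ 2).
  by rewrite xE ler_expR; exact: ler_1Dsqr.
have h3 : 2 <= expR 1 :> R by have := expR_ge1Dx (1 : R); lra.
have -> : 2 + y ^+ 2 = 1 + (1 + y ^+ 2) by ring.
rewrite expRD; nra.
Qed.

(** Each entry has at most [2 * eta^-1 * U * S^p * (1 + R)] levels, [S = 2 (p + 1) (1 + R)]. The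
    summands are exponents dominating these factors in the same order, mostly by [x <= expR x]. *)
Definition log_grid_card U (inv_eta p l : R) :=
  (p + 1) ^+ 3 * (2 + inv_eta + U + p * (2 * (p + 1) + (2 + l ^+ 2)) + (2 + l ^+ 2)).

Lemma card_grid_index_le (p : nat) (Rr eta U : R) : 0 < Rr -> 0 < eta -> eta <= 1 -> 1 <= U ->
  #|{: grid_index p Rr (eta / (U * (2 * p.+1%:R * (1 + Rr)) ^+ p))}|%:R
  <= expR (log_grid_card U eta^-1 p%:R (ln Rr)).
Proof.
move=> R0 eta0 eta1 U1; set S := 2 * p.+1%:R * (1 + Rr); set delta := eta / _.
have p1 : 1 <= p.+1%:R :> R by rewrite ler1n.
have S1 : 1 <= S by rewrite /S; nra.
have Sp1 : 1 <= S ^+ p by rewrite exprn_ege1.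
have A1 : 1 <= U * S ^+ p by rewrite mulr_ege1.
have A0 : 0 < U * S ^+ p by lra.
have delta0 : 0 < delta by rewrite divr_gt0.
set k := Num.truncn (2 * Rr / delta).
have k1 : k.+1%:R <= 2 * (eta^-1 * (U * S ^+ p)) * (1 + Rr).
  have e1 : 1 <= eta^-1 by rewrite invf_ge1.
  have h : k%:R <= 2 * Rr / delta by rewrite truncn_le divr_ge0 ?(ltW delta0)// mulr_ge0// ltW.
  have dE : 2 * Rr / delta = 2 * (eta^-1 * (U * S ^+ p)) * Rr.
    by rewrite /delta invf_div; ring.
  have B1 : 1 <= eta^-1 * (U * S ^+ p) by rewrite mulr_ege1.
  rewrite -natr1; move: B1 h; rewrite dE; set t := eta^-1 * _ => B1 h; lra.
have -> : #|{: grid_index p Rr delta}| = (k.+1 ^ (p.+1 ^ 3))%N.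
  by rewrite card_ffun !card_prod !card_ord -mulnA.
rewrite /log_grid_card natr1 -(natrX _ p.+1 3) expRM_natl natrX.
rewrite lerXn2r ?nnegrE ?expR_ge0//; apply: (le_trans k1).
set ll := 2 + ln Rr ^+ 2.
have hR : 1 + Rr <= expR ll by exact: one_add_le_expR_sqr_ln.
clearbody ll.
have hS : S ^+ p <= expR (p%:R * (2 * p.+1%:R + ll)).
  rewrite expRM_natl lerXn2r ?nnegrE ?expR_ge0//; first lra.
  by rewrite expRD ler_pM ?le_expR//; lra.
have i0 : 0 <= eta^-1 by rewrite invr_ge0 ltW.
have US0 := ltW A0; have iUS0 := mulr_ge0 i0 US0.
rewrite (expRD _ ll) (expRD _ (p%:R * _)) (expRD _ U) (expRD 2).
apply: ler_pM => //; [by rewrite mulr_ge0|lra|].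
rewrite -!mulrA; apply: ler_pM => //; first exact: le_expR.
apply: ler_pM => //; first exact: le_expR.
by apply: ler_pM => //; [lra|lra|exact: le_expR].
Qed.

(** With [e = eps^-1] and [r = rho^-1] this gives [M / K = eps * rho / (32 (1 + D))]; the factor
    [rho] pays for the [rho^-1] lost in Markov's inequality. *)
Definition trunc_level M e r D := 32 * (1 + D) * M * e * r.

(** The prefactor inverts the Hoeffding rate at accuracy [eps / 8] and range [(D + K)^2];
    [32 * e * (D + K)] is the inverse mesh, and [4 * r] stands in for the nonpolynomial
    [log (4 / rho)]. *)
Definition sample_size M U (e p l r D : R) :=
  let K := trunc_level M e r D in
  8 ^+ 2 * 128 * (D + K) ^+ 4 * e ^+ 2 * (log_grid_card U (32 * e * (D + K)) p l + 4 * r).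

(** Empirical risk minimization: [E1] is near [S1 <= S2], which is near [E2]; each passage costs
    [t / 2]. *)
Lemma compare_by_deviation (n E1 E2 S1 S2 t : R) : 0 < n -> S1 <= S2 ->
  `|n * E1 - S1| <= n * (t / 2) -> `|n * E2 - S2| <= n * (t / 2) -> E1 <= E2 + t.
Proof.
move=> n0 h; rewrite !ler_norml => /andP[_ h1] /andP[h2 _].
by rewrite -(ler_pM2l n0); lra.
Qed.

Lemma trunc_level_ge1 M eps rho D : 1 <= M -> 0 < eps -> eps <= 1 -> 0 < rho -> rho <= 1 ->
  0 < D -> 1 <= trunc_level M eps^-1 rho^-1 D.
Proof.
move=> M1 e0 e1 r0 r1 D0; rewrite /trunc_level !mulr_ege1// ?invf_ge1//; lra.
Qed.

Lemma mesh_le1 eps D K : eps <= 1 -> 0 < D -> 1 <= K -> eps / (32 * (D + K)) <= 1.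
Proof. by move=> e1 D0 K1; rewrite ler_pdivrMr; lra. Qed.

(** The four terms in the parenthesis are at most [eps / 16], [eps / 8], [eps / 8] and [eps / 8],
    using [D / (1 + D) <= 1]. *)
Lemma accuracy_le M eps rho D K : 0 < M -> 0 < eps -> 0 < rho <= 1 -> 0 < D ->
  K = trunc_level M eps^-1 rho^-1 D ->
  2 * (2 * D * (M / K) + 4 * (eps / (32 * (D + K))) * (D + K) + eps / 8
       + 2 * D * (2 * (M / K) / rho)) <= eps.
Proof.
move=> M0 e0 /andP[r0 r1] D0 KE.
have K0 : 0 < K by rewrite KE /trunc_level !mulr_gt0// ?invr_gt0//; lra.
have MK : M / K = eps * rho / (32 * (1 + D)).
  rewrite KE /trunc_level; field.
  by rewrite !gt_eqF//; lra.
have h1 : D / (1 + D) <= 1 by rewrite ler_pdivrMr; lra.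
have h0 : 0 <= D / (1 + D) by rewrite divr_ge0; lra.
have -> : 2 * D * (M / K) = D / (1 + D) * rho * eps / 16.
  by rewrite MK; field; rewrite !gt_eqF//; lra.
have -> : 4 * (eps / (32 * (D + K))) * (D + K) = eps / 8.
  by field; rewrite !gt_eqF//; lra.
have -> : 2 * D * (2 * (M / K) / rho) = D / (1 + D) * eps / 8.
  by rewrite MK; field; rewrite !gt_eqF//; lra.
move: (D / (1 + D)) h0 h1 => t t0 t1.
have a1 : t * rho <= 1 by nra.
have a2 : t * rho * eps <= eps by nra.
have a3 : t * eps <= eps by nra.
lra.
Qed.

(** [expR Q] cancels the cardinality, and [2 * expR (- 4 / rho) <= rho / 2] since [x <= expR x]. *)
Lemma failure_le (N Q D K rho eps m : R) : 0 < D -> 0 < K -> 0 < rho -> 0 < eps ->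
  0 <= N -> N <= expR Q ->
  8 ^+ 2 * 128 * (D + K) ^+ 4 * eps^-1 ^+ 2 * (Q + 4 * rho^-1) <= m ->
  2 * N * expR (- (m * ((eps / 8) ^+ 2 / (128 * ((D + K) ^+ 2) ^+ 2)))) <= rho / 2.
Proof.
move=> D0 K0 r0 e0 N0 NQ hm.
have DK : 0 < D + K by lra.
set c := 8 ^+ 2 * 128 * _ * _ in hm.
have c0 : 0 < c by rewrite !mulr_gt0 ?exprn_gt0 ?invr_gt0.
have cE : (eps / 8) ^+ 2 / (128 * ((D + K) ^+ 2) ^+ 2) = c^-1.
  by rewrite /c; field; rewrite !gt_eqF.
have h : Q + 4 / rho <= m / c by rewrite ler_pdivlMr// mulrC.
rewrite cE; apply: (@le_trans _ _ (2 * expR Q * expR (- (Q + 4 / rho)))).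
  apply: ler_pM; [by rewrite mulr_ge0|exact: expR_ge0| |by rewrite ler_expR lerN2].
  by rewrite ler_wpM2l.
rewrite opprD expRD mulrA -(mulrA 2) -expRD subrr expR0 mulr1 expRN.
rewrite ler_pdivrMr ?expR_gt0//.
by have := le_expR (4 / rho); rewrite ler_pdivrMr// => h'; lra.
Qed.

End sample_size.

Lemma sample_size_polynomial (R : realType) (C U : R) (q : nat) :
  polynomial (fun x : 'I_5 -> R =>
    sample_size (C * x (@Ordinal 5 1 isT) ^+ q.+1) U (x (@Ordinal 5 0 isT))
      (x (@Ordinal 5 1 isT)) (x (@Ordinal 5 2 isT)) (x (@Ordinal 5 3 isT))
      (x (@Ordinal 5 4 isT))).
Proof.
rewrite /sample_size /log_grid_card /trunc_level.
by repeat first [ exact: polynomial_cst | exact: polynomial_var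
  | apply: polynomialD | apply: polynomialM | apply: polynomialX ].
Qed.

(** * Excess risk for one dimension and one architecture *)

Section fixed_dimension.
Context (R : realType) (dO : measure_display) (Omega : measurableType dO)
  (P : probability Omega R).
Variables (u v : R) (d : nat) (X Y : Omega -> 'I_d -> R) (phi : ('I_d -> R) -> R).
Variables (xs ys : nat -> Omega -> 'I_d -> R) (a : seq nat) (Rr D M : R).
Hypotheses (ha : arch d a) (R_gt0 : 0 < Rr) (D_gt0 : 0 < D) (M_ge1 : 1 <= M).
Hypotheses (mX : rvec X) (cX : forall w, cube u v (X w)) (mY : rvec Y).
Hypothesis mphi : borel_fun phi.
Hypothesis hxs : forall i, rvec (xs i) /\ rvec (ys i) /\ (forall w, cube u v (xs i w)) /\
  same_law P (fun w => vcat (xs i w) (ys i w)) (fun w => vcat (X w) (Y w)).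
Hypothesis hindep : mutually_indep P (fun i w => vcat (xs i w) (ys i w)).
Hypothesis hM : (\int[P]_w (phi (Y w) ^+ 2)%:E <= M%:E)%E.

Let S := Rn R (d + d).
Let fstv (z : S) : Rn R d := fun j => z (lshift d j).
Let sndv (z : S) : Rn R d := fun j => z (rshift d j).
Let psi (z : S) : R := phi (sndv z).
Let net W b (z : S) : R := clip D (realization a W b (fstv z)).
Let V i w : S := vcat (xs i w) (ys i w).
Let V0 w : S := vcat (X w) (Y w).

Let fstv_vcat x y : fstv (vcat x y) = x.
Proof. by apply/funext => j; rewrite /fstv /vcat (unsplitK (inl j)). Qed.

Let sndv_vcat x y : sndv (vcat x y) = y.
Proof. by apply/funext => j; rewrite /sndv /vcat (unsplitK (inr j)). Qed.

Let mvcat (x y : Omega -> 'I_d -> R) : rvec x -> rvec y ->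
  measurable_fun setT ((fun w => vcat (x w) (y w)) : Omega -> S).
Proof.
move=> mx my; apply: measurable_rvec => k; rewrite /vcat.
by case: (fintype.split k) => j; [exact: mx | exact: my].
Qed.

Let mV i : measurable_fun setT (V i).
Proof. by have [mx [my _]] := hxs i; exact: mvcat. Qed.

Let mV0 : measurable_fun setT V0.
Proof. exact: mvcat. Qed.

Let mpsi : measurable_fun setT psi.
Proof.
apply: (measurableT_comp (borel_funP mphi)); apply: measurable_rvec => j.
exact: measurable_coord.
Qed.

Let mnet W b : measurable_fun setT (net W b).
Proof.
apply: measurableT_comp; first exact: measurable_clip.
by apply: measurable_realization => j; exact: measurable_coord.
Qed.

Let net_bounded W b z : `|net W b z| <= D. Proof. exact: clip_bounded. Qed.

Let psi2 : (\int[P]_w (psi (V0 w) ^+ 2)%:E <= M%:E)%E.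
Proof. by under eq_integral => w _ do rewrite /psi sndv_vcat. Qed.

Variables (m : nat) (eps rho : R).
Hypotheses (m_gt0 : (0 < m)%N) (eps_gt0 : 0 < eps) (eps_lt1 : eps < 1).
Hypotheses (rho_gt0 : 0 < rho) (rho_lt1 : rho < 1).
Hypothesis hm : sample_size M (1 + `|u| + `|v|) eps^-1 (nparams a)%:R (ln Rr) rho^-1 D <= m%:R.

Let K := trunc_level M eps^-1 rho^-1 D.
Let eta := eps / (32 * (D + K)).

Let K_ge1 : 1 <= K.
Proof.
by apply: trunc_level_ge1 => //; exact: ltW.
Qed.

Let K_gt0 : 0 < K. Proof. exact: lt_le_trans ltr01 K_ge1. Qed.
Let DK_gt0 : 0 < D + K. Proof. exact: addr_gt0. Qed.
Let eta_gt0 : 0 < eta. Proof. by rewrite divr_gt0// mulr_gt0. Qed.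

Let eta_le1 : eta <= 1.
Proof.
by apply: mesh_le1 => //; exact: ltW.
Qed.

Let exists_good : exists G : set Omega, [/\ measurable G, (P (~` G) <= rho%:E)%E &
  forall w, G w -> forall W b, param_bounded a W b Rr ->
    `|m%:R * (\int[P]_w cross_loss psi (net W b) (V0 w))%R
      - \sum_(i < m) cross_loss psi (net W b) (V i w)| <= m%:R * (eps / 2)].
Proof.
pose U : R := 1 + `|u| + `|v|.
have U1 : 1 <= U by rewrite /U -addrA lerDl addr_ge0.
have A0 : 0 < U * (2 * (nparams a).+1%:R * (1 + Rr)) ^+ nparams a.
  by rewrite mulr_gt0 ?(lt_le_trans ltr01 U1)// exprn_gt0// !mulr_gt0// addr_gt0.
pose delta := eta / (U * (2 * (nparams a).+1%:R * (1 + Rr)) ^+ nparams a).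
have delta0 : 0 < delta by rewrite divr_gt0.
pose I := grid_index (nparams a) Rr delta.
have M0 : 0 < M by exact: lt_le_trans ltr01 M_ge1.
have MK0 : 0 < M / K by rewrite divr_gt0.
have CV0 w : cube u v (fstv (V0 w)) by rewrite fstv_vcat.
have CV i w : cube u v (fstv (V i w)).
  by rewrite fstv_vcat; have [_ [_ [cx _]]] := hxs i.
have V_law i A : measurable A -> P (V i @^-1` A) = P (V0 @^-1` A).
  by have [_ [_ [_ law]]] := hxs i; exact: law.
have mg (k : I) : measurable_fun setT (fun z : S => grid_net D k (fstv z)).
  exact: mnet.
have gD (k : I) (z : S) : `|grid_net D k (fstv z)| <= D by exact: clip_bounded.
(* This threshold makes the Markov probability [(M / K) / s] equal to [rho / 2]. *)
have s0 : 0 < 2 * (M / K) / rho by rewrite divr_gt0// mulr_gt0.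
have e81 : eps / 8 <= 1.
  by rewrite ler_pdivrMr// mul1r (le_trans (ltW eps_lt1))// ler1n.
have e80 : 0 < eps / 8 by rewrite divr_gt0.
have [G [mG PG dev]] := @uniform_deviation R _ _ Omega S P V V0 mV mV0 V_law hindep
  D K M eta psi D_gt0 K_ge1 mpsi psi2 I (fun k z => grid_net D k (fstv z))
  [set z | cube u v (fstv z)] m _ _ CV0 CV mg gD e80 e81 s0 m_gt0.
exists G; split => //.
- apply: (le_trans PG); rewrite lee_fin [leRHS]splitr; apply: lerD; last first.
    rewrite le_eqVlt; apply/orP; left; apply/eqP.
    by move: (M / K) MK0 => t t0; field; rewrite !gt_eqF.
  apply: (@failure_le _ _ (log_grid_card U eta^-1 (nparams a)%:R (ln Rr))) => //.
    exact: card_grid_index_le.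
  apply: le_trans hm; rewrite /sample_size -/K (_ : eta^-1 = 32 * eps^-1 * (D + K))//.
  by rewrite /eta invf_div mulrAC.
- move=> w Gw W b hW; apply: le_trans (dev w Gw (net W b) (mnet W b) (net_bounded W b) _) _.
    have [k hk] := @grid_net_cover _ u v Rr D delta d a
      (fun x => clip D (realization a W b x)) ha R_gt0 D_gt0 delta0
      (ex_intro _ W (ex_intro _ b (conj hW (fun _ _ => erefl)))).
    exists k => z /hk; rewrite -mulrA -/U /delta divfK// gt_eqF//.
  rewrite ler_wpM2l// ler_pdivlMr// mulrC /eta.
  by apply: accuracy_le => //; rewrite rho_gt0 ltW.
Qed.

Lemma excess_risk_le (fs : ('I_d -> R) -> R) (fe : Omega -> ('I_d -> R) -> R) :
  NetClass u v a Rr D fs ->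
  (forall x, cube u v x -> measurable_fun setT (fe ^~ x)) ->
  (forall w, NetClass u v a Rr D (fe w)) ->
  (forall w, \sum_(i < m) (fe w (xs i w) - phi (ys i w)) ^+ 2
             <= \sum_(i < m) (fs (xs i w) - phi (ys i w)) ^+ 2) ->
  ((1 - rho)%:E <= P [set w |
     (\int[P]_w' ((fe w (X w') - phi (Y w')) ^+ 2)%:E
      <= \int[P]_w' ((fs (X w') - phi (Y w')) ^+ 2)%:E + eps%:E)%E])%E.
Proof.
move=> fsH mfe feH fe_min; set T := [set w | _].
have mphiY : measurable_fun setT (fun w => phi (Y w)).
  apply: eq_measurable_fun (measurableT_comp mpsi mV0) => w _ /=.
  by rewrite /psi sndv_vcat.
(* The inclusion of [G] in [T] compares probabilities only once [T] is known to be measurable. *)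
have mT : measurable T.
  apply: (measurable_risk P mX cX mphiY mfe) => w.
  exact: net_class_lip (feH w).
have [G [mG PG dev]] := exists_good.
have riskE f W b : (forall x, cube u v x -> f x = clip D (realization a W b x)) ->
    (\int[P]_w ((f (X w) - phi (Y w)) ^+ 2)%:E =
     ((\int[P]_w cross_loss psi (net W b) (V0 w))%R)%:E + \int[P]_w (psi (V0 w) ^+ 2)%:E)%E.
  move=> fE; rewrite -(risk_decomposition mV0 D_gt0 mpsi psi2 (mnet W b) (net_bounded W b)).
  by apply: eq_integral => w _; rewrite /net /psi fstv_vcat sndv_vcat fE.
have lossE f W b : (forall x, cube u v x -> f x = clip D (realization a W b x)) ->
    forall w, \sum_(i < m) (f (xs i w) - phi (ys i w)) ^+ 2 =
      \sum_(i < m) cross_loss psi (net W b) (V i w) + \sum_(i < m) phi (ys i w) ^+ 2.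
  move=> fE w; rewrite -big_split; apply: eq_bigr => i _ /=.
  have [_ [_ [cx _]]] := hxs i.
  by rewrite /cross_loss /net /psi fstv_vcat sndv_vcat fE//; ring.
have GT : G `<=` T.
  move=> w Gw; rewrite /T /=.
  have [Ws [bs [hWs fsE]]] := fsH; have [We [be [hWe feE]]] := feH w.
  (* The parameters [We], [be] depend on [w]; this is harmless, as the bound on [G] holds for all
     parameters at once. *)
  have hs := dev w Gw _ _ hWs; have he := dev w Gw _ _ hWe.
  have := fe_min w; rewrite (lossE _ _ _ fsE) (lossE _ _ _ feE) lerD2r => hmin.
  rewrite (riskE _ _ _ fsE) (riskE _ _ _ feE) addeAC -EFinD leeD2r//  lee_fin.
  apply: (compare_by_deviation _ hmin he hs); by rewrite ltr0n.
have PGE : P G = (1 - P (~` G))%E by rewrite probability_setC// oppeB// addeA subee// add0e.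
apply: (@le_trans _ _ (P G)); last by apply: le_measure; rewrite ?inE.
rewrite PGE EFinB leeB//.
Qed.

End fixed_dimension.

(** * Choice of the polynomial and conclusion *)

Theorem theorem3p9 (R : realType) (dO : measure_display) (Omega : measurableType dO)
  (P : probability Omega R) (u v : R) (huv : u < v)
  (X Y : forall d : nat, Omega -> ('I_d -> R))
  (phi : forall d : nat, ('I_d -> R) -> R)
  (xs ys : forall d : nat, nat -> Omega -> ('I_d -> R))
  (fH : forall d : nat, seq nat -> R -> R -> ('I_d -> R) -> R)
  (femp : forall d : nat, seq nat -> R -> R -> nat -> Omega -> ('I_d -> R) -> R)
  (* the data *)
  (hX : forall d, rvec (X d) /\ (forall w, cube u v (X d w)) /\ uniform_cube P u v (X d))
  (hY : forall d, rvec (Y d))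
  (hphi : forall d, borel_fun (phi d))
  (* (x_i, y_i) i.i.d. copies of (X_d, Y_d) *)
  (hcopies : forall d,
     (forall i, rvec (xs d i) /\ rvec (ys d i) /\ (forall w, cube u v (xs d i w)) /\
        same_law P (fun w => vcat (xs d i w) (ys d i w)) (fun w => vcat (X d w) (Y d w))) /\
     mutually_indep P (fun i w => vcat (xs d i w) (ys d i w)))
  (* f_{d,H}: minimizer of the risk over H = N_{a,R,D} *)
  (hfH : forall d a Rr D, arch d a -> 0 < Rr -> 0 < D ->
     NetClass u v a Rr D (fH d a Rr D) /\
     forall g, NetClass u v a Rr D g ->
       (\int[P]_w ((fH d a Rr D (X d w) - phi d (Y d w)) ^+ 2)%:E
        <= \int[P]_w ((g (X d w) - phi d (Y d w)) ^+ 2)%:E)%E)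
  (* f_{d,m,H}: measurable minimizer of the empirical risk over H = N_{a,R,D} *)
  (hfemp : forall d a Rr D m, arch d a -> 0 < Rr -> 0 < D -> (0 < m)%N ->
     (forall x, cube u v x -> measurable_fun setT (fun w => femp d a Rr D m w x)) /\
     forall w, NetClass u v a Rr D (femp d a Rr D m w) /\
     forall g, NetClass u v a Rr D g ->
       (m%:R)^-1 * \sum_(i < m) (femp d a Rr D m w (xs d i w) - phi d (ys d i w)) ^+ 2
       <= (m%:R)^-1 * \sum_(i < m) (g (xs d i w) - phi d (ys d i w)) ^+ 2)
  (* condition (i) *)
  (c1 : R) (hc1 : 0 < c1)
  (hi : forall d (t : R) (i : 'I_d), 1 <= t ->
     Pr P [set w | t <= `|Y d w i|] <= 2 * expR (- c1 * (ln t) ^+ 2))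
  (* condition (ii) *)
  (c2 lam : R) (hc2 : 0 < c2) (hlam : 2 <= lam)
  (hii : forall d (y : 'I_d -> R), `|phi d y| <= c2 * (1 + norm2 y `^ lam)) :
  exists h : mpoly.mpoly 5 R,
    forall (d : nat) (a : seq nat) (Rr D eps rho : R) (m : nat),
      arch d a -> 0 < Rr -> 0 < D -> 0 < eps < 1 -> 0 < rho < 1 -> (0 < m)%N ->
      mpoly.meval (fun k : 'I_5 => [:: eps^-1; (nparams a)%:R; ln Rr; rho^-1; D]`_k) h
        <= m%:R ->
      ((1 - rho)%:E <=
       P [set w | (\int[P]_w' ((femp d a Rr D m w (X d w') - phi d (Y d w')) ^+ 2)%:E
                   <= \int[P]_w' ((fH d a Rr D (X d w') - phi d (Y d w')) ^+ 2)%:E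
                      + eps%:E)%E])%E.
Proof.
pose q := (Num.truncn lam).+1.
have lam0 : 0 <= lam by exact: le_trans hlam.
have lamq : lam <= q%:R by apply/ltW/truncnS_gt.
pose Mom : R := 1 + 4 * expR ((2 * q)%:R + ((2 * q)%:R + 1) ^+ 2 / (4 * c1)).
have Mom0 : 0 <= Mom by rewrite addr_ge0// mulr_ge0// expR_ge0.
(* [C * P(a)^(q+1)] bounds the second moment of [phi(Y)] for every [d]; the leading 1 keeps it at
   least 1, as the truncation level requires. *)
pose C : R := 1 + 2 * c2 ^+ 2 * (4 + Mom).
have c220 : 0 <= 2 * c2 ^+ 2 by rewrite mulr_ge0// sqr_ge0.
have C1 : 1 <= C by rewrite lerDl mulr_ge0// addr_ge0.
have [h hE] := sample_size_polynomial C (1 + `|u| + `|v|) q.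
exists h => d a Rr D eps rho m ha R0 D0 /andP[e0 e1] /andP[r0 r1] m0.
rewrite hE /= => hm.
have [dp _ _ p0] := nparams_bounds ha.
(* [arch] makes all widths positive and [d] is the first of them, which rules out [d = 0]. *)
have d0 : (0 < d)%N.
  by case: ha => + [<- [_]]; case: (a) => //= n ws _ /andP[].
have [mX [cX _]] := hX d.
have [hxs hind] := hcopies d.
have [fHm _] := hfH d a Rr D ha R0 D0.
have [mfe fe_min] := hfemp d a Rr D m ha R0 D0 m0.
have p1 : 1 <= (nparams a)%:R ^+ q.+1 :> R by rewrite exprn_ege1// ler1n.
have mphiY : measurable_fun setT (fun w => phi d (Y d w)).
  exact: (measurableT_comp (borel_funP (hphi d)) (measurable_rvec (hY d))).
have M1 : 1 <= C * (nparams a)%:R ^+ q.+1 by rewrite mulr_ege1.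
have phi2 : (\int[P]_w (phi d (Y d w) ^+ 2)%:E <= (C * (nparams a)%:R ^+ q.+1)%:E)%E.
  apply: le_trans (second_moment_le d0 (hY d) mphiY hc1 (@hi d) hc2 lam0 lamq (hii d)) _.
  rewrite lee_fin -/Mom.
  have dq : d%:R ^+ q.+1 <= (nparams a)%:R ^+ q.+1 :> R.
    by rewrite lerXn2r ?nnegrE// ler_nat.
  apply: (@le_trans _ _ (2 * c2 ^+ 2 * (4 + Mom) * (nparams a)%:R ^+ q.+1)).
    rewrite -(mulrA (2 * c2 ^+ 2)) ler_wpM2l// mulrDl; apply: lerD; first by rewrite ler_peMr.
    by rewrite mulrC ler_wpM2l.
  by rewrite ler_wpM2r ?(le_trans ler01 p1)// lerDr.
apply: (excess_risk_le ha R0 D0 M1 mX cX (hY d) (hphi d) hxs hind phi2 m0 e0 e1 r0 r1 hm) => //.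
- by move=> w; have [] := fe_min w.
- move=> w; have [_ /(_ _ fHm)] := fe_min w.
  by rewrite ler_pM2l// invr_gt0 ltr0n.
Qed.
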